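(* For $n=3,4,5$, the numbers of (ordinary) gaussoids, oriented gaussoids, positive gaussoids and uniform oriented gaussoids on $[n]$ are as follows. For $n=3$: $11$ ordinary, $51$ oriented, $8$ positive, $20$ uniform. For $n=4$: $679$ ordinary, $34{,}873$ oriented, $64$ positive, $5{,}376$ uniform. For $n=5$: $60{,}212{,}776$ ordinary, $54{,}936{,}241{,}913$ oriented, $1{,}024$ positive, $878{,}349{,}984$ uniform.
   Context: $[n]=\{1,\dots,n\}$. $\mathcal{P}=\{p_I: I\subseteq[n]\}$ and $\mathcal{A}=\{a_{ij|K}: i,j\in[n]\text{ distinct},\,K\subseteq[n]\setminus\{i,j\}\}$ are sets of unknowns with $a_{ij|K}=a_{ji|K}$. Write $ijL$ for $\{i,j\}\cup L$, etc. The edge trinomials are the following polynomials, for all pairwise distinct $i,j,k\in[n]$ and $L\subseteq[n]\setminus\{i,j,k\}$: $p_{iL}\,a_{jk|L}-p_L\,a_{jk|iL}-a_{ij|L}\,a_{ik|L}$; $p_{ijL}\,a_{ik|L}-p_{iL}\,a_{ik|jL}-a_{ij|L}\,a_{jk|iL}$; $p_{ijkL}\,a_{ij|L}-p_{ijL}\,a_{ij|kL}-a_{ik|jL}\,a_{jk|iL}$. An (ordinary) gaussoid is a subset $\mathcal{G}\subseteq\mathcal{A}$ such that for all pairwise distinct $i,j,k\in[n]$ and $L\subseteq[n]\setminus\{i,j,k\}$: (G1) $\{a_{ij|L},a_{ik|jL}\}\subset\mathcal{G}$ implies $\{a_{ik|L},a_{ij|kL}\}\subset\mathcal{G}$; (G2)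 $\{a_{ij|kL},a_{ik|jL}\}\subset\mathcal{G}$ implies $\{a_{ij|L},a_{ik|L}\}\subset\mathcal{G}$; (G3) $\{a_{ij|L},a_{ik|L}\}\subset\mathcal{G}$ implies $\{a_{ij|kL},a_{ik|jL}\}\subset\mathcal{G}$; (G4) $\{a_{ij|L},a_{ij|kL}\}\subset\mathcal{G}$ implies $a_{ik|L}\in\mathcal{G}$ or $a_{jk|L}\in\mathcal{G}$. An oriented gaussoid is a map $\mathcal{A}\to\{0,\pm1\}$ such that for each edge trinomial, after setting all elements of $\mathcal{P}$ to $+1$ and all elements of $\mathcal{A}$ to their images, the set of values of the three signed terms of the trinomial is $\{0\}$, $\{-1,+1\}$ or $\{-1,0,+1\}$. A positive gaussoid is an oriented gaussoid with image contained in $\{0,1\}$. A uniform oriented gaussoid is an oriented gaussoid with image contained in $\{\pm1\}$. *)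

(* Defs.v *)
From Stdlib Require Import BinNat.
From mathcomp Require Import all_boot all_order all_algebra.

Set Implicit Arguments.
Unset Strict Implicit.
Unset Printing Implicit Defensive.

Import GRing.Theory.
Local Open Scope ring_scope.

(* The ground set [n] is 'I_n.  An unknown a_{ij|K} is encoded by the pair    *)
(* ({i, j}, K), so that a_{ij|K} = a_{ji|K} holds by construction.            *)
Definition aindex (n : nat) := ({set 'I_n} * {set 'I_n})%type.

Definition avar (n : nat) (i j : 'I_n) (K : {set 'I_n}) : aindex n :=
  ([set i; j], K).

Definition Avars (n : nat) : {set aindex n} :=
  [set x : aindex n | (#|x.1| == 2) && (x.2 \subset ~: x.1)].

Lemma avar_in_Avars (n : nat) (i j : 'I_n) (K : {set 'I_n}) :
  (avar i j K \in Avars n) = [&& i != j, i \notin K & j \notin K].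
Proof.
rewrite inE /= cards2; case: (eqVneq i j) => //= _.
by rewrite subsetC subUset !sub1set !inE.
Qed.

Definition admissible (n : nat) (i j k : 'I_n) (L : {set 'I_n}) : bool :=
  uniq [:: i; j; k] && (L \subset ~: [set i; j; k]).

Definition gaussoid_axioms (n : nat) (G : {set aindex n})
    (i j k : 'I_n) (L : {set 'I_n}) : bool :=
  [&& (avar i j L \in G) && (avar i k (j |: L) \in G) ==>
        (avar i k L \in G) && (avar i j (k |: L) \in G),
      (avar i j (k |: L) \in G) && (avar i k (j |: L) \in G) ==>
        (avar i j L \in G) && (avar i k L \in G),
      (avar i j L \in G) && (avar i k L \in G) ==>
        (avar i j (k |: L) \in G) && (avar i k (j |: L) \in G)
    & (avar i j L \in G) && (avar i j (k |: L) \in G) ==>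
        (avar i k L \in G) || (avar j k L \in G)].

Definition gaussoid (n : nat) (G : {set aindex n}) : bool :=
  (G \subset Avars n) &&
  [forall i : 'I_n, forall j : 'I_n, forall k : 'I_n, forall L : {set 'I_n},
     admissible i j k L ==> gaussoid_axioms G i j k L].

(* An unknown is either some p_I (left) or some a_{ij|K} (right).  A signed   *)
(* term is an integer coefficient with the list of its factors; a polynomial  *)
(* is kept as the list of its signed terms.                                   *)
Definition unknown (n : nat) := ({set 'I_n} + aindex n)%type.
Definition term (n : nat) := (int * seq (unknown n))%type.

Definition p_ (n : nat) (I : {set 'I_n}) : unknown n := inl I.
Definition a_ (n : nat) (i j : 'I_n) (K : {set 'I_n}) : unknown n :=
  inr (avar i j K).

Definition edge_trinomials (n : nat) (i j k : 'I_n) (L : {set 'I_n}) :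
    seq (seq (term n)) :=
  [:: [:: (1, [:: p_ (i |: L); a_ j k L]);
          (-1, [:: p_ L; a_ j k (i |: L)]);
          (-1, [:: a_ i j L; a_ i k L])];
      [:: (1, [:: p_ (i |: (j |: L)); a_ i k L]);
          (-1, [:: p_ (i |: L); a_ i k (j |: L)]);
          (-1, [:: a_ i j L; a_ j k (i |: L)])];
      [:: (1, [:: p_ (i |: (j |: (k |: L))); a_ i j L]);
          (-1, [:: p_ (i |: (j |: L)); a_ i j (k |: L)]);
          (-1, [:: a_ i k (j |: L); a_ j k (i |: L)])]].

Definition sign : finType := seq_sub [:: -1; 0; 1 : int].

Definition sign_map (n : nat) := {ffun {x : aindex n | x \in Avars n} -> sign}.

(* The value 0 off Avars is a dummy: for admissible i, j, k, L every a-index  *)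
(* occurring in an edge trinomial lies in Avars.                              *)
Definition assign (n : nat) (f : sign_map n) (v : unknown n) : int :=
  match v with
  | inl _ => 1
  | inr x => if insub x is Some u then val (f u) else 0
  end.

Definition term_value (n : nat) (f : sign_map n) (t : term n) : int :=
  t.1 * \prod_(v <- t.2) assign f v.

(* The set of the values in s is {0}, {-1, 1} or {-1, 0, 1}.                  *)
Definition balanced (s : seq int) : bool :=
  has (perm_eq (undup s)) [:: [:: 0]; [:: -1; 1]; [:: -1; 0; 1]].

Definition oriented_gaussoid (n : nat) (f : sign_map n) : bool :=
  [forall i : 'I_n, forall j : 'I_n, forall k : 'I_n, forall L : {set 'I_n},
     admissible i j k L ==>
       all (fun t => balanced (map (term_value f) t))
           (edge_trinomials i j k L)].

Definition positive_gaussoid (n : nat) (f : sign_map n) : bool :=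
  oriented_gaussoid f && [forall x, val (f x) \in [:: 0; 1]].

Definition uniform_oriented_gaussoid (n : nat) (f : sign_map n) : bool :=
  oriented_gaussoid f && [forall x, val (f x) \in [:: -1; 1]].

Definition num_gaussoids (n : nat) : nat := #|@gaussoid n|.
Definition num_oriented (n : nat) : nat := #|@oriented_gaussoid n|.
Definition num_positive (n : nat) : nat := #|@positive_gaussoid n|.
Definition num_uniform (n : nat) : nat := #|@uniform_oriented_gaussoid n|.

(* Main.v *)
Require Import Defs.
From HB Require Import structures.
From Stdlib Require Import BinNat.
From mathcomp Require Import all_boot all_order all_algebra.

Set Implicit Arguments.
Unset Strict Implicit.
Unset Printing Implicit Defensive.

Local Open Scope nat_scope.

(** Call square the set of all I between K and ijK, for i, j and K as in
    a_{ij|K}: it is a 2-face of the n-cube of subsets of [n], so an assignment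
    of signs to the unknowns labels the squares of the n-cube. The three edge
    trinomials at i, j, k, L, for all six orders of i, j, k, involve exactly the
    six squares of the 3-face of all I between L and ijkL. Hence an oriented
    gaussoid is a labelling of the squares of the n-cube that satisfies one
    local condition at every 3-face, and so is an ordinary gaussoid, with
    another condition and the two labels in, out. Positive and uniform oriented
    gaussoids are those with labels in {0, 1} and in {-1, 1}. The four counts
    are therefore treated alike: a labelling is a word over an alphabet vals,
    and the words in which every 3-face obeys a rule are to be counted
    ([card_oriented], [card_gaussoids]).

    For n = 3 and n = 4 (6 and 24 squares) the solutions are listed by
    backtracking. For n = 5 there are 80 squares and too many solutions, and
    the count goes as follows. Cut the 5-cube in direction 4 into two 4-cubes,
    labelled by words A and D of 24 letters, and a link of 32 squares between
    them. For fixed A, each square of D shares a 3-face with one square of A and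
    four squares of the link, and the admissible letters at this square of D are
    none, a single one, or all of them. So each filling of the link that is
    compatible with A gives a pattern of 24 letters over vals and the wild card
    [Any], and the number of extensions of A to the 5-cube is the number of
    pairs of such a pattern and a solution D on the 4-cube that fits it
    ([extensionsE]).

    Both families are kept as tries, in which words with a common future are
    merged. The link consists of a square c_v over every vertex v of a 3-cube
    and two squares B_e and C_e over every edge e, where the words B and C each
    have to fit A at the squares of a 3-cube of A, which leaves few
    possibilities. The trie of patterns is made by a walk over the vertices and
    edges that consumes B and C letter by letter ([eval_climb]), and the
    fitting pairs are counted by a simultaneous descent ([joinE]).

    The number of extensions of A does not change under permutations of the
    directions 0, 1, 2, 3, nor under the sign changes of an oriented gaussoid
    that negate all a_{ij|K} with i fixed. So it is computed for one A in every
    orbit only ([sweepE]), for 259 instead of 34873 words in the oriented case.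
    For the same reason, changing the signs of all squares in direction 4, it
    suffices to let one link square take one letter of each pair of opposite
    letters ([gauge_flips]).

    What remains is a computation with tries; it is carried out by evaluation
    in the last part. *)

(** * Letters and words *)

(** The letters are signs. [Any] is not one of them: it occurs in patterns only,
    where it stands for all letters. *)
Inductive letter := Mi | Ze | Pl | Any.

Definition letter_eqb (x y : letter) : bool :=
  match x, y with
  | Mi, Mi | Ze, Ze | Pl, Pl | Any, Any => true
  | _, _ => false
  end.

Lemma letter_eqP : Equality.axiom letter_eqb.
Proof. by do 2!case; constructor. Qed.

HB.instance Definition _ := hasDecEq.Build letter letter_eqP.

Fixpoint words (vals : seq letter) (n : nat) : seq (seq letter) :=
  if n is n'.+1 then [seq x :: w | x <- vals, w <- words vals n'] else [:: [::]].

Lemma mem_words vals n w :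
  (w \in words vals n) = (size w == n) && all (mem vals) w.
Proof.
elim: n w => [|n IHn] [|x w] //=; first by apply/allpairsP => -[[y v] []].
rewrite eqSS andbCA -IHn; apply/allpairsP/andP => [[[y v] [? ? [-> ->]]]|[? ?]] //.
by exists (x, w).
Qed.

Lemma uniq_words vals n : uniq vals -> uniq (words vals n).
Proof.
move=> uv; elim: n => [//|n IHn] /=.
by apply: allpairs_uniq => // -[x w] [y v] _ _ [-> ->].
Qed.

Lemma sum_wordsS vals n (F : seq letter -> nat) :
  \sum_(w <- words vals n.+1) F w =
  \sum_(x <- vals) \sum_(w <- words vals n) F (x :: w).
Proof. by rewrite /= big_allpairs_dep. Qed.

Lemma sum_words0 vals (F : seq letter -> nat) :
  \sum_(w <- words vals 0) F w = F [::].
Proof. by rewrite big_seq1. Qed.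

Lemma sum_words_cat vals m n (F : seq letter -> nat) :
  \sum_(w <- words vals (m + n)) F w =
  \sum_(u <- words vals m) \sum_(v <- words vals n) F (u ++ v).
Proof.
elim: m F => [|m IHm] F; first by rewrite add0n sum_words0.
by rewrite addSn !sum_wordsS; apply: eq_bigr => x _; rewrite IHm.
Qed.

Lemma eq_sum_words vals n (F G : seq letter -> nat) :
  (forall w, size w = n -> all (mem vals) w -> F w = G w) ->
  \sum_(w <- words vals n) F w = \sum_(w <- words vals n) G w.
Proof.
move=> FG; rewrite big_seq [RHS]big_seq; apply: eq_bigr => w.
by rewrite mem_words => /andP[/eqP sw vw]; apply: FG.
Qed.

(** * Weighted tries *)

(** A trie stands for a finite family of words with multiplicities; [One] is a
    [Node] with a single child. The family is only ever used through the sums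
    [eval] of functions over it, so that every operation on tries is described by
    its effect on [eval]. *)
Inductive tree :=
  | Nil | Leaf of N | One of letter & tree | Node of tree & tree & tree & tree.

(** Uniform depth is what makes [add] lossless: two tries of the same depth never
    meet in a leaf and an inner node. *)
Fixpoint ht (n : nat) (t : tree) {struct t} : bool :=
  match t, n with
  | Nil, _ => true
  | Leaf _, 0 => true
  | One _ t, n.+1 => ht n t
  | Node a b c d, n.+1 => [&& ht n a, ht n b, ht n c & ht n d]
  | _, _ => false
  end.

Fixpoint eval (t : tree) (f : seq letter -> nat) : nat :=
  match t with
  | Nil => 0
  | Leaf n => nat_of_bin n * f [::]
  | One k t => eval t (fun w => f (k :: w))
  | Node a b c d =>
      eval a (fun w => f (Mi :: w)) + eval b (fun w => f (Ze :: w))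
      + eval c (fun w => f (Pl :: w)) + eval d (fun w => f (Any :: w))
  end.

Lemma eq_eval n t f g : ht n t -> (forall w, size w = n -> f w = g w) ->
  eval t f = eval t g.
Proof.
elim: t n f g => [|m|k t IHt|a IHa b IHb c IHc d IHd] [|n] f g //=.
- by move=> _ ->.
- by move=> ht_t fg; apply: IHt ht_t _ => w sw; rewrite fg //= sw.
case/and4P=> ha hb hc hd fg.
by congr (_ + _ + _ + _); [apply: IHa ha _|apply: IHb hb _|apply: IHc hc _
  |apply: IHd hd _] => w sw; rewrite fg //= sw.
Qed.

Lemma eval_ext t f g : f =1 g -> eval t f = eval t g.
Proof.
elim: t f g => [|m|k t IHt|a IHa b IHb c IHc d IHd] f g fg //=.
- by rewrite fg.
- by apply: IHt => w; apply: fg.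
by congr (_ + _ + _ + _); [apply: IHa|apply: IHb|apply: IHc|apply: IHd] => w;
  apply: fg.
Qed.

Lemma eval0 t : eval t (fun=> 0) = 0.
Proof.
by elim: t => [|m|k t IHt|a IHa b IHb c IHc d IHd] //=;
  rewrite ?muln0 // IHa IHb IHc IHd.
Qed.

Lemma addn4ACA a b c d a' b' c' d' :
  (a + a') + (b + b') + (c + c') + (d + d')
  = (a + b + c + d) + (a' + b' + c' + d').
Proof. by rewrite (addnACA a) (addnACA (a + b)) (addnACA (a + b + c)). Qed.

Lemma evalD t f g : eval t (fun w => f w + g w) = eval t f + eval t g.
Proof.
elim: t f g => [|m|k t IHt|a IHa b IHb c IHc d IHd] f g //=.
- by rewrite mulnDr.
- by rewrite IHa IHb IHc IHd addn4ACA.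
Qed.

Lemma evalM t m f : eval t (fun w => m * f w) = m * eval t f.
Proof.
elim: t f => [|n|k t IHt|a IHa b IHb c IHc d IHd] f //=.
- by rewrite muln0.
- by rewrite mulnCA.
- by rewrite IHa IHb IHc IHd !mulnDr.
Qed.

Lemma eval_swap s t (f : seq letter -> seq letter -> nat) :
  eval s (fun v => eval t (f v)) = eval t (fun w => eval s (fun v => f v w)).
Proof.
elim: s f => [|n|k s IHs|a IHa b IHb c IHc d IHd] f /=.
- by rewrite eval0.
- by rewrite evalM.
- exact: IHs.
- by rewrite !evalD IHa IHb IHc IHd.
Qed.

Fixpoint add (s t : tree) {struct s} : tree :=
  match s with
  | Nil => t
  | Leaf m => match t with Leaf n => Leaf (N.add m n) | _ => s end
  | One k s1 =>
    match t with
    | One l t1 =>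
      match k, l with
      | Mi, Mi | Ze, Ze | Pl, Pl | Any, Any => One k (add s1 t1)
      | Mi, Ze => Node s1 t1 Nil Nil
      | Mi, Pl => Node s1 Nil t1 Nil
      | Mi, Any => Node s1 Nil Nil t1
      | Ze, Mi => Node t1 s1 Nil Nil
      | Ze, Pl => Node Nil s1 t1 Nil
      | Ze, Any => Node Nil s1 Nil t1
      | Pl, Mi => Node t1 Nil s1 Nil
      | Pl, Ze => Node Nil t1 s1 Nil
      | Pl, Any => Node Nil Nil s1 t1
      | Any, Mi => Node t1 Nil Nil s1
      | Any, Ze => Node Nil t1 Nil s1
      | Any, Pl => Node Nil Nil t1 s1
      end
    | Node a b c d =>
      match k with
      | Mi => Node (add s1 a) b c d
      | Ze => Node a (add s1 b) c d
      | Pl => Node a b (add s1 c) d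
      | Any => Node a b c (add s1 d)
      end
    | _ => s
    end
  | Node a b c d =>
    match t with
    | One l t1 =>
      match l with
      | Mi => Node (add a t1) b c d
      | Ze => Node a (add b t1) c d
      | Pl => Node a b (add c t1) d
      | Any => Node a b c (add d t1)
      end
    | Node a' b' c' d' => Node (add a a') (add b b') (add c c') (add d d')
    | _ => s
    end
  end.

Lemma nat_of_binD m n : nat_of_bin (N.add m n) = m + n.
Proof. by case: m n => [|p] [|q] //=; rewrite ?addn0 // nat_of_add_pos. Qed.

Lemma nat_of_binM m n : nat_of_bin (N.mul m n) = m * n.
Proof. by case: m n => [|p] [|q] //=; rewrite ?muln0 // nat_of_mul_pos. Qed.

Lemma ht_add n s t : ht n s -> ht n t -> ht n (add s t).
Proof.
elim: s n t => [|m|k s IHs|a IHa b IHb c IHc d IHd] [|n] [|m'|l t|a' b' c' d'] //=.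
- by move=> hs ht_t; case: k; case: l => /=; rewrite ?IHs ?hs ?ht_t.
- by case: k => hs /and4P[ha hb hc hd] /=; rewrite ?ha ?hb ?hc ?hd IHs.
- by case: l => /and4P[ha hb hc hd] ht_t /=; rewrite ?ha ?hb ?hc ?hd ?IHa ?IHb ?IHc ?IHd.
- by move=> /and4P[ha hb hc hd] /and4P[*]; rewrite IHa // IHb // IHc // IHd.
Qed.

Lemma eval_add n s t f : ht n s -> ht n t ->
  eval (add s t) f = eval s f + eval t f.
Proof.
elim: s n t f => [|m|k s IHs|a IHa b IHb c IHc d IHd] [|n] [|m'|l t|a' b' c' d'] f //=;
  rewrite ?addn0 //.
- by rewrite nat_of_binD mulnDl.
- by case: k; case: l => /= hs ht_t; rewrite ?(IHs n) ?addn0 ?add0n // addnC.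
- by case: k => hs /and4P[ha hb hc hd] /=; rewrite (IHs n) // 1?[in LHS]addnCA -!addnA.
- case: l => /and4P[ha hb hc hd] ht_t /=.
  + by rewrite (IHa n) // !(addnAC _ (eval t _)).
  + by rewrite (IHb n) // addnA !(addnAC _ (eval t _)).
  + by rewrite (IHc n) // addnA !(addnAC _ (eval t _)).
  + by rewrite (IHd n) // addnA.
by case/and4P=> ha hb hc hd /and4P[ha' hb' hc' hd'];
  rewrite (IHa n) // (IHb n) // (IHc n) // (IHd n) // addn4ACA.
Qed.

Definition grow (k : letter) (t : tree) : tree := if t is Nil then Nil else One k t.

Lemma eval_grow k t f : eval (grow k t) f = eval t (fun w => f (k :: w)).
Proof. by case: t. Qed.

Lemma ht_grow n k t : ht n t -> ht n.+1 (grow k t).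
Proof. by case: t. Qed.

Fixpoint scale (m : N) (t : tree) : tree :=
  match t with
  | Nil => Nil
  | Leaf n => Leaf (N.mul m n)
  | One k t => One k (scale m t)
  | Node a b c d => Node (scale m a) (scale m b) (scale m c) (scale m d)
  end.

Lemma ht_scale n m t : ht n (scale m t) = ht n t.
Proof.
elim: t n => [|m'|k t IHt|a IHa b IHb c IHc d IHd] [|n] //=.
by rewrite IHa IHb IHc IHd.
Qed.

Lemma eval_scale m t f : eval (scale m t) f = m * eval t f.
Proof.
elim: t f => [|m'|k t IHt|a IHa b IHb c IHc d IHd] f //=.
- by rewrite muln0.
- by rewrite nat_of_binM mulnA.
- by rewrite IHa IHb IHc IHd !mulnDr.
Qed.

Definition weigh (m : N) (t : tree) : tree := if m is Npos xH then t else scale m t.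

Lemma ht_weigh n m t : ht n (weigh m t) = ht n t.
Proof. by case: m => [|[p|p|]] //=; exact: ht_scale. Qed.

Lemma eval_weigh m t f : eval (weigh m t) f = m * eval t f.
Proof. by case: m => [|[p|p|]] /=; rewrite ?mul1n //; exact: eval_scale. Qed.

Fixpoint graft (s t : tree) : tree :=
  match s with
  | Nil => Nil
  | Leaf m => weigh m t
  | One k s => One k (graft s t)
  | Node a b c d => Node (graft a t) (graft b t) (graft c t) (graft d t)
  end.

Lemma ht_graft m n s t : ht m s -> ht n t -> ht (m + n) (graft s t).
Proof.
elim: s m => [|k|k s IHs|a IHa b IHb c IHc d IHd] [|m] //= hs ht_t.
- by rewrite ht_weigh add0n.
- exact: IHs.
- by case/and4P: hs => ? ? ? ?; rewrite IHa // IHb // IHc // IHd.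
Qed.

Lemma eval_graft s t f :
  eval (graft s t) f = eval s (fun v => eval t (fun w => f (v ++ w))).
Proof.
elim: s f => [|k|k s IHs|a IHa b IHb c IHc d IHd] f //=.
- exact: eval_weigh.
- by rewrite IHa IHb IHc IHd.
Qed.

(** The function to be summed over a family in order to sum f over the tails of
    the words with first letter in q. *)
Definition guard (q : pred letter) (f : seq letter -> nat) (w : seq letter) : nat :=
  if w is x :: w' then (if q x then f w' else 0) else 0.

Definition child (x : letter) (t : tree) : tree :=
  match t with
  | One k t => match x, k with Mi, Mi | Ze, Ze | Pl, Pl => t | _, _ => Nil end
  | Node a b c _ => match x with Mi => a | Ze => b | Pl => c | Any => Nil end
  | _ => Nil
  end.

Lemma ht_child n x t : ht n.+1 t -> ht n (child x t).
Proof.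
by case: t => [|m|k t|a b c d] //=; [case: x; case: k | case: x => /and4P[]].
Qed.

Lemma eval_child x t f :
  eval (child x t) f = eval t (guard (fun y => (x != Any) && (y == x)) f).
Proof.
case: t => [|m|k t|a b c d] /=; rewrite ?muln0 //.
  by case: x; case: k => //=; rewrite eval0.
by case: x => //=; rewrite !eval0 ?addn0 ?add0n.
Qed.

(** Functions on the three proper letters, stored as a table. *)
Inductive tri (T : Type) := Tri of T & T & T.

Definition get T (u : tri T) (x : letter) : T :=
  let: Tri a b c := u in match x with Mi => a | Ze => b | _ => c end.

Definition tabulate T (f : letter -> T) : tri T := Tri (f Mi) (f Ze) (f Pl).

Definition pick (u : tri bool) (t : tree) : tree :=
  match t with
  | One k t =>
    let: Tri x y z := u in
    if match k with Mi => x | Ze => y | Pl => z | Any => false end then t else Nil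
  | Node a b c _ =>
    let: Tri x y z := u in
    let r := if z then c else Nil in
    let r := if y then add b r else r in
    if x then add a r else r
  | _ => Nil
  end.

Definition chosen (u : tri bool) (x : letter) : bool := (x != Any) && get u x.

Lemma ht_pick n u t : ht n.+1 t -> ht n (pick u t).
Proof.
case: t u => [|m|k t|a b c d] [x y z] //=.
  by case: ifP.
by case/and4P=> ha hb hc hd; case: x; case: y; case: z;
  rewrite ?ht_add ?hc.
Qed.

Lemma eval_pick n u t f : ht n.+1 t ->
  eval (pick u t) f = eval t (guard (chosen u) f).
Proof.
case: t u => [|m|k t|a b c d] [x y z] //=; rewrite ?muln0 //.
  by case: k; case: x; case: y; case: z; rewrite /= ?eval0.
case/and4P=> ha hb hc hd.
by case: x; case: y; case: z; rewrite ?(@eval_add n) ?ht_add //= ?eval0 ?addn0 ?addnA.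
Qed.

(** * Joining two tries *)

Definition fits (x k : letter) : bool :=
  match x, k with
  | Mi, Mi | Ze, Ze | Pl, Pl | Mi, Any | Ze, Any | Pl, Any => true
  | _, _ => false
  end.

Definition is_nil (t : tree) : bool := if t is Nil then true else false.

(** When p is a pattern trie and d a trie of words, [Any] concerns all children of
    d. The child p4 for [Any] would have to be joined with each of d1, d2, d3; it
    is instead added to one of p1, p2, p3 and joined with the sum of the other
    two children of d, which saves recursive calls. The child to which p4 is added
    is chosen so that no empty child spoils the saving. *)
Fixpoint join (n : nat) (p d : tree) : N :=
  match n with
  | 0 => match p, d with Leaf i, Leaf j => N.mul i j | _, _ => 0%num end
  | n.+1 =>
    match d with
    | One x d =>
      match p with
      | One k p => if fits x k then join n p d else 0%num
      | Node p1 p2 p3 p4 =>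
        match x with
        | Mi => join n (add p1 p4) d
        | Ze => join n (add p2 p4) d
        | Pl => join n (add p3 p4) d
        | Any => 0%num
        end
      | _ => 0%num
      end
    | Node d1 d2 d3 _ =>
      match p with
      | One k p =>
        match k with
        | Mi => join n p d1
        | Ze => join n p d2
        | Pl => join n p d3
        | Any => join n p (add d1 (add d2 d3))
        end
      | Node p1 p2 p3 p4 =>
        if is_nil p4 then N.add (join n p1 d1) (N.add (join n p2 d2) (join n p3 d3))
        else if is_nil p1 || is_nil d1 then
          N.add (join n (add p3 p4) d3)
            (N.add (N.add (join n p1 d1) (join n p2 d2)) (join n p4 (add d1 d2)))
        else
          N.add (join n (add p1 p4) d1)
            (N.add (N.add (join n p2 d2) (join n p3 d3)) (join n p4 (add d2 d3)))
      | _ => 0%num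
      end
    | _ => 0%num
    end
  end.

Definition pairing (p d : tree) : nat :=
  eval p (fun v => eval d (fun w => all2 fits w v)).

Lemma pairing_addl n p p' d : ht n p -> ht n p' ->
  pairing (add p p') d = pairing p d + pairing p' d.
Proof. exact: eval_add. Qed.

Lemma pairing_addr n p d d' : ht n d -> ht n d' ->
  pairing p (add d d') = pairing p d + pairing p d'.
Proof.
move=> hd hd'; rewrite /pairing -evalD.
by apply: eval_ext => v; apply: eval_add hd hd'.
Qed.

Lemma pairing_One k p x d :
  pairing (One k p) (One x d) = if fits x k then pairing p d else 0.
Proof.
rewrite /pairing /=; case: ifP => _ /=; first by [].
by rewrite -[RHS](eval0 p); apply: eval_ext => v; apply: eval0.
Qed.

Lemma pairing_Nodel p1 p2 p3 p4 d : pairing (Node p1 p2 p3 p4) d =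
  pairing (One Mi p1) d + pairing (One Ze p2) d + pairing (One Pl p3) d
  + pairing (One Any p4) d.
Proof. by []. Qed.

Lemma pairing_Noder p d1 d2 d3 d4 : pairing p (Node d1 d2 d3 d4) =
  pairing p (One Mi d1) + pairing p (One Ze d2) + pairing p (One Pl d3)
  + pairing p (One Any d4).
Proof. by rewrite /pairing /= -!evalD. Qed.

Lemma pairing0r p : pairing p Nil = 0.
Proof. exact: eval0. Qed.

Lemma joinE n p d : ht n p -> ht n d -> nat_of_bin (join n p d) = pairing p d.
Proof.
elim: n p d => [|n IHn] p d.
  case: p => [|i|? ?|? ? ? ?] //; case: d => [|j|? ?|? ? ? ?] //= _ _.
    by rewrite /pairing /= muln0.
  by rewrite nat_of_binM /pairing /= muln1.
case: d => [|//|x d|d1 d2 d3 d4] hp /=; first by rewrite pairing0r.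
  move=> hd; case: p hp => [//|//|k p|p1 p2 p3 p4] /=.
    by move=> hp; rewrite pairing_One; case: ifP => // _; apply: IHn.
  case/and4P=> h1 h2 h3 h4; rewrite pairing_Nodel !pairing_One.
  by case: x; rewrite /= ?IHn ?ht_add ?(@pairing_addl n) ?addn0.
case/and4P=> g1 g2 g3 g4; case: p hp => [//|//|k p|p1 p2 p3 p4] /=.
  move=> hp; rewrite pairing_Noder !pairing_One.
  by case: k; rewrite /= ?IHn ?ht_add ?(@pairing_addr n) ?ht_add ?addn0 ?addnA.
case/and4P=> h1 h2 h3 h4.
rewrite pairing_Nodel !pairing_Noder !pairing_One /= !addn0 !add0n.
case: ifP => [|_].
  by case: p4 h4 => // _ _; rewrite !nat_of_binD !IHn // !addn0 !addnA.
case: ifP => _; rewrite !nat_of_binD !IHn ?ht_add //.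
  rewrite (@pairing_addl n) // (@pairing_addr n) //.
  by rewrite addnACA (addnC (pairing p3 d3)) (addnC (pairing p4 d3)).
by rewrite (@pairing_addl n) // (@pairing_addr n) // addnACA !addnA.
Qed.

(** * Backtracking *)

Definition entries (s : seq letter) (idx : seq nat) : seq letter :=
  [seq nth Ze s i | i <- idx].

Definition constraint := (seq nat * (seq letter -> bool))%type.

Definition holds (s : seq letter) (c : constraint) : bool := c.2 (entries s c.1).

Definition last_index (c : constraint) : nat := foldr maxn 0 c.1.

(** The search extends a word letter by letter and keeps it in reverse, so that
    positions have to be counted from the last letter, at position k. *)
Definition rebase (k : nat) (c : constraint) : constraint :=
  ([seq k - i | i <- c.1], c.2).

Definition due (cs : seq constraint) (k : nat) : seq constraint :=
  [seq rebase k c | c <- cs & last_index c == k].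

Definition branch (vals : seq letter) (g : letter -> tree) : tree :=
  foldr (fun x t => add (grow x (g x)) t) Nil vals.

Arguments branch : simpl never.

Fixpoint solve (vals : seq letter) (stages : seq (seq constraint))
    (fin : seq letter -> tree) (env : seq letter) : tree :=
  if stages is cs :: stages then
    branch vals (fun x => let env := x :: env in
      if all (holds env) cs then solve vals stages fin env else Nil)
  else fin env.

Lemma ht_branch vals n (g : letter -> tree) :
  (forall x, ht n (g x)) -> ht n.+1 (branch vals g).
Proof.
move=> hg; elim: vals => [//|x vals IH].
by apply: ht_add IH; apply: ht_grow.
Qed.

Lemma eval_branch vals n (g : letter -> tree) f : (forall x, ht n (g x)) ->
  eval (branch vals g) f = \sum_(x <- vals) eval (g x) (fun w => f (x :: w)).
Proof.
move=> hg; elim: vals => [|x vals IH]; first by rewrite big_nil.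
rewrite big_cons -IH -eval_grow.
by apply: eval_add (ht_grow _ _) (ht_branch _ _).
Qed.

(** What the search tests on its way along w. *)
Fixpoint meets (stages : seq (seq constraint)) (env w : seq letter) : bool :=
  match stages, w with
  | cs :: stages, x :: w =>
      all (holds (x :: env)) cs && meets stages (x :: env) w
  | _, _ => true
  end.

Section Solve.

Variables (vals : seq letter) (m : nat) (fin : seq letter -> tree).
Hypothesis ht_fin : forall env, ht m (fin env).

Lemma ht_solve stages env : ht (size stages + m) (solve vals stages fin env).
Proof.
elim: stages env => [|cs stages IH] env /=; first exact: ht_fin.
by rewrite addSn; apply: ht_branch => x; case: ifP.
Qed.

Lemma eval_solve stages env f :
  eval (solve vals stages fin env) f =
  \sum_(w <- words vals (size stages))
    if meets stages env w then eval (fin (catrev w env)) (fun v => f (w ++ v))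
    else 0.
Proof.
elim: stages env f => [|cs stages IH] env f; first by rewrite sum_words0.
have hg x : ht (size stages + m)
    (if all (holds (x :: env)) cs then solve vals stages fin (x :: env) else Nil).
  by case: (all _ _); rewrite // ht_solve.
rewrite [size _]/= sum_wordsS /= (eval_branch _ _ hg).
apply: eq_bigr => x _; case: (all _ _) => /=; last by rewrite big1_eq.
exact: IH.
Qed.

End Solve.

Lemma leq_last_index (c : constraint) i : i \in c.1 -> i <= last_index c.
Proof.
case: c => idx q; rewrite /last_index /=.
elim: idx => [//|j idx IH] /=; rewrite inE leq_max => /orP[/eqP->|/IH->];
  by rewrite ?leqnn ?orbT.
Qed.

Lemma holds_rebase k c u w : size u = k.+1 -> last_index c = k ->
  holds (rev u) (rebase k c) = holds (u ++ w) c.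
Proof.
move=> su lc; rewrite /holds /=; congr (c.2 _).
rewrite /entries -map_comp; apply/eq_in_map => i /leq_last_index.
rewrite lc => ik /=; have ltu j : j <= k -> j < size u by rewrite su ltnS.
by rewrite nth_cat ltu // nth_rev ?ltu ?leq_subr // su subSS subKn.
Qed.

Lemma meets_due cs k n u w : size u = k -> size w = n ->
  meets [seq due cs i | i <- iota k n] (rev u) w =
  all (holds (u ++ w)) [seq c <- cs | k <= last_index c < k + n].
Proof.
elim: n k u w => [|n IHn] k u [|x w] //= su.
  by rewrite (@eq_filter _ _ pred0) ?filter_pred0 // => c; rewrite addn0 ltnNge andbN.
move=> [sw]; rewrite -rev_rcons (IHn k.+1 (rcons u x)) ?size_rcons ?su //.
rewrite cat_rcons !all_filter all_map all_filter -all_predI.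
apply: eq_all => c; have due_c : last_index c = k ->
    holds (rev (rcons u x)) (rebase k c) = holds (u ++ x :: w) c.
  by move=> kc; rewrite -cat_rcons; apply: holds_rebase; rewrite ?size_rcons ?su.
rewrite /predI /= -/(holds _ (rebase k c)) addSnnS (leq_eqVlt k).
case: (eqVneq (last_index c) k) => [kc|nk] //=.
by rewrite kc ltnn /= addnS ltnS leq_addr /= andbT -due_c.
Qed.

(** Every constraint is tested once, as soon as its last letter is known. *)
Lemma meets_all cs n w : size w = n -> all (fun c => last_index c < n) cs ->
  meets [seq due cs i | i <- iota 0 n] [::] w = all (holds w) cs.
Proof.
move=> sw lcs; rewrite (@meets_due cs 0 n [::] w) // add0n.
by have /all_filterP-> : all (fun c => 0 <= last_index c < n) cs.
Qed.

(** * Local rules *)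

(** The squares of the 3-face at i, j, k, L are listed as three pairs of opposite
    ones, jk|L, jk|iL, ik|L, ik|jL, ij|L, ij|kL. Permuting i, j, k permutes the
    pairs and keeps the order within each pair; these are the six turns. *)
Definition turns (T : Type) (s : seq T) : seq (seq T) :=
  if s is [:: a; a'; b; b'; c; c'] then
    [:: [:: a; a'; b; b'; c; c']; [:: a; a'; c; c'; b; b'];
        [:: b; b'; a; a'; c; c']; [:: b; b'; c; c'; a; a'];
        [:: c; c'; a; a'; b; b']; [:: c; c'; b; b'; a; a']]
  else [::].

Lemma map_turns (T U : Type) (f : T -> U) s :
  turns (map f s) = map (map f) (turns s).
Proof. by do 7?[case: s => [|? s] //]. Qed.

Definition cube (rule : seq letter -> bool) (s : seq letter) : bool :=
  all rule (turns s).

Lemma turns_size (T : Type) (s t : seq T) : size s != 6 -> turns s = [::].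
Proof. by do 7?[case: s => [|? s] //]. Qed.

Lemma cube_turns rule s t : t \in turns s -> cube rule t = cube rule s.
Proof.
case: (eqVneq (size s) 6) => [|ns]; last by rewrite turns_size.
do 7?[case: s => [|? s] //] => _.
by rewrite !inE /cube /= => /or4P[|||/or3P[]] /eqP-> /=;
  do 6!bool_congr.
Qed.

(** The letters that complete a 3-face in which the other five squares are
    known, as a pattern: a is the opposite square, b1, ..., b4 are the side
    squares. Two or three admissible letters are encoded by [Any] alike, which
    is right if they are all letters of the alphabet; [classes_ok] tests it. *)
Definition class_of (vals : seq letter) (rule : seq letter -> bool)
    (a b1 b2 b3 b4 : letter) : option letter :=
  let ok d := (d \in vals) && cube rule [:: a; d; b1; b2; b3; b4] in
  match ok Mi, ok Ze, ok Pl with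
  | false, false, false => None
  | true, false, false => Some Mi
  | false, true, false => Some Ze
  | false, false, true => Some Pl
  | _, _, _ => Some Any
  end.

Definition class_table := tri (tri (tri (tri (tri (option letter))))).

Definition make_classes vals rule : class_table :=
  tabulate (fun a => tabulate (fun b1 => tabulate (fun b2 => tabulate (fun b3 =>
    tabulate (class_of vals rule a b1 b2 b3))))).

Definition class_at (T : class_table) (s : seq letter) : option letter :=
  if s is [:: a; b1; b2; b3; b4] then get (get (get (get (get T a) b1) b2) b3) b4
  else None.

Definition allows (o : option letter) (d : letter) : bool :=
  if o is Some k then fits d k else false.

(** The local condition at a 3-face, read off from the table of classes. *)
Definition obeys (T : class_table) (s : seq letter) : bool :=
  if s is a :: d :: e then allows (class_at T (a :: e)) d else false.

(** Let a be a lower square and c, c' two side squares opposite to each other. The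
    pairs (y, z) of letters for the other two side squares which give the class
    k to the upper square are grouped into boxes: [Box u z k] stands for the
    pairs with y in u. *)
Inductive box := Box of tri bool & letter & letter.

Definition boxes_of (vals : seq letter) (T : class_table) (a c c' : letter) : seq box :=
  flatten [seq pmap (fun k =>
      let u := tabulate (fun y =>
        (y \in vals) && (class_at T [:: a; y; z; c; c'] == Some k)) in
      if [|| get u Mi, get u Ze | get u Pl] then Some (Box u z k) else None)
    [:: Mi; Ze; Pl; Any] | z <- vals].

Definition box_table := tri (tri (tri (seq box))).

Definition make_boxes vals T : box_table :=
  tabulate (fun a => tabulate (fun c => tabulate (boxes_of vals T a c))).

Definition in_box (y z : letter) (bx : box) : bool :=
  let: Box u z' _ := bx in chosen u y && ((z' != Any) && (z == z')).

Definition box_class (bx : box) : letter := let: Box _ _ k := bx in k.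

Definition step_class (vals : seq letter) (T : class_table) a c c' y z : option letter :=
  if (y \in vals) && (z \in vals) then class_at T [:: a; y; z; c; c'] else None.

Definition four (P : letter -> bool) : bool := [&& P Mi, P Ze, P Pl & P Any].

Lemma fourP P : four P -> forall x, P x.
Proof. by case/and4P=> ? ? ? ? []. Qed.

Definition classes_ok (vals : seq letter) rule (T : class_table) : bool :=
  all (fun a => all (fun d => all (fun b1 => all (fun b2 => all (fun b3 =>
    all (fun b4 => obeys T [:: a; d; b1; b2; b3; b4]
                   == cube rule [:: a; d; b1; b2; b3; b4])
    vals) vals) vals) vals) vals) vals.

Lemma classes_okP vals rule T : classes_ok vals rule T ->
  forall s, size s = 6 -> all (mem vals) s -> obeys T s = cube rule s.
Proof.
move=> ok s; do 7?[case: s => [|? s] //] => _.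
case/and5P=> va vd v1 v2 /and3P[v3 v4 _].
move/allP: ok => /(_ _ va)/allP/(_ _ vd)/allP/(_ _ v1)/allP/(_ _ v2).
by move=> /allP/(_ _ v3)/allP/(_ _ v4)/eqP.
Qed.

(** A pair of letters lies in exactly one box if it has a class and in none
    otherwise. So a sum over the boxes is a sum over the pairs. *)
Definition boxes_ok (vals : seq letter) (T : class_table) (X : box_table) : bool :=
  all (fun a => all (fun c => all (fun c' => four (fun y => four (fun z =>
    [seq box_class bx | bx <- get (get (get X a) c) c' & in_box y z bx]
    == (if step_class vals T a c c' y z is Some k then [:: k] else [::]))))
    vals) vals) vals.

(** * Steps of a walk through two tries *)

(** The step along an edge consumes one letter of each trie and appends the class
    of the box that the two letters lie in; [next] makes the remaining steps.
    All the letters of a box are treated at once. *)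
Fixpoint edges (bxs : seq box) (b c : tree) (next : tree -> tree -> tree) : tree :=
  if bxs is Box u z k :: bxs then
    let c' := child z c in
    if is_nil c' then edges bxs b c next else
    let b' := pick u b in
    if is_nil b' then edges bxs b c next else
    add (grow k (next b' c')) (edges bxs b c next)
  else Nil.

Definition edge (X : tri (tri (seq box))) (c0 c1 : letter) (b c : tree)
    (next : tree -> tree -> tree) : tree :=
  edges (get (get X c0) c1) b c next.

Fixpoint sums (vals : seq letter) (next : letter -> tree) : tree :=
  if vals is x :: vals then add (next x) (sums vals next) else Nil.

Fixpoint wsums (starts : seq (letter * N)) (c : tree)
    (next : letter -> tree -> tree) : tree :=
  if starts is (x, m) :: starts then
    add (next x (weigh m c)) (wsums starts c next)
  else Nil.

(** The tries are merged in every step, so what a sequence of steps does to single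
    words can only be seen from sums: [K v w] lists the patterns that the steps
    would make of a word v from the first and a word w from the second trie. *)
Definition kernel := seq letter -> seq letter -> seq (seq letter).

Definition yields (m n p : nat) (next : tree -> tree -> tree) (K : kernel) :=
  forall b c, ht m b -> ht n c ->
  ht p (next b c) /\
  forall f, eval (next b c) f = eval b (fun v => eval c (fun w =>
    \sum_(u <- K v w) f u)).

Lemma yields_graft m n : yields m n (m + n) graft (fun v w => [:: v ++ w]).
Proof.
move=> b c hb hc; split=> [|f]; first exact: ht_graft.
rewrite eval_graft; apply: eval_ext => v; apply: eval_ext => w.
by rewrite big_seq1.
Qed.

Definition sum_kernel (vals : seq letter) (K : letter -> kernel) : kernel :=
  fun v w => flatten [seq K x v w | x <- vals].

Lemma yields_sums m n p vals (next : letter -> tree -> tree -> tree) K :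
  (forall x, x \in vals -> yields m n p (next x) (K x)) ->
  yields m n p (fun b c => sums vals (fun x => next x b c)) (sum_kernel vals K).
Proof.
move=> yK b c hb hc; elim: vals yK => [|x vals IH] yK /=.
  split=> // f; transitivity (eval b (fun=> 0)); first by rewrite eval0.
  apply: eval_ext => v; transitivity (eval c (fun=> 0)); first by rewrite eval0.
  by apply: eval_ext => w; rewrite /sum_kernel big_nil.
have [y vy|IHh IHe] := IH; first by apply: yK; rewrite inE vy orbT.
have [hx ex] := yK x (mem_head _ _) b c hb hc; split=> [|f]; first exact: ht_add.
rewrite (eval_add _ hx IHh) ex IHe -evalD; apply: eval_ext => v.
rewrite -evalD; apply: eval_ext => w.
by rewrite /sum_kernel /= big_cat.
Qed.

Lemma count_sum_kernel p vals K v w :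
  count p (sum_kernel vals K v w) = \sum_(x <- vals) count p (K x v w).
Proof.
elim: vals => [|x vals IH]; first by rewrite big_nil.
by rewrite big_cons -IH /sum_kernel /= count_cat.
Qed.

Definition edge_kernel (step : letter -> letter -> option letter) (K : kernel) :
    kernel := fun v w =>
  match v, w with
  | y :: v, z :: w => if step y z is Some k then map (cons k) (K v w) else [::]
  | _, _ => [::]
  end.

Lemma is_nilP t : reflect (t = Nil) (is_nil t).
Proof. by case: t => *; constructor. Qed.

Lemma eval_guard2 b c p q (F : seq letter -> seq letter -> nat) :
  eval b (guard p (fun v => eval c (guard q (F v)))) =
  eval b (fun v => eval c (fun w =>
    match v, w with
    | y :: v', z :: w' => if p y && q z then F v' w' else 0
    | _, _ => 0
    end)).
Proof.
apply: eval_ext => -[|y v] /=; first by rewrite eval0.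
case: (p y) => /=; first by apply: eval_ext => -[].
by rewrite -[LHS](eval0 c); apply: eval_ext => -[].
Qed.

(** The test for empty children cuts the recursion and does not change the
    sums. *)
Lemma yields_edges m n p bxs next K step :
    (forall y z, [seq box_class bx | bx <- bxs & in_box y z bx]
                 = if step y z is Some k then [:: k] else [::]) ->
    yields m n p next K ->
  yields m.+1 n.+1 p.+1 (fun b c => edges bxs b c next) (edge_kernel step K).
Proof.
move=> stepE yK b c hb hc.
(* The share of the box bx in the sum at the words v and w. *)
pose G f v w (bx : box) := match v, w with
  | y :: v', z :: w' =>
      if in_box y z bx then \sum_(u <- K v' w') f (box_class bx :: u) else 0
  | _, _ => 0
  end.
suff [he eE] : ht p.+1 (edges bxs b c next) /\ forall f, eval (edges bxs b c next) f
    = eval b (fun v => eval c (fun w => \sum_(bx <- bxs) G f v w bx)).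
  split=> // f; rewrite eE; apply: eval_ext => v; apply: eval_ext => w.
  case: v => [|y v]; first by rewrite big_nil big1_eq.
  case: w => [|z w]; first by rewrite big_nil big1_eq.
  rewrite /G -big_mkcond -big_filter /= .
  rewrite -(big_map box_class xpredT (fun k => \sum_(u <- K v w) f (k :: u))).
  rewrite stepE; case: (step y z) => [k|]; last by rewrite !big_nil.
  by rewrite big_seq1 big_map.
elim: bxs {stepE} => [|[u z k] bxs [IHh IHe]].
  split=> // f; rewrite -[LHS](eval0 b); apply: eval_ext => v.
  rewrite -[LHS](eval0 c); apply: eval_ext => w; by rewrite big_nil.
set rest := edges bxs b c next in IHh IHe *.
have hb' := ht_pick u hb; have hc' := ht_child z hc.
have [hn en] := yK _ _ hb' hc'.
pose t := add (grow k (next (pick u b) (child z c))) rest.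
have ht_t : ht p.+1 t by apply: ht_add => //; apply: ht_grow.
have evN f : eval (next (pick u b) (child z c)) (fun w => f (k :: w)) =
    eval b (fun v => eval c (fun w => G f v w (Box u z k))).
  rewrite en (@eval_pick m) //.
  transitivity (eval b (guard (chosen u) (fun v =>
      eval c (guard (fun y => (z != Any) && (y == z))
        (fun w => \sum_(u <- K v w) f (k :: u)))))).
    by apply: eval_ext => -[|y v] //=; case: (chosen u y) => //; rewrite eval_child.
  by rewrite eval_guard2; apply: eval_ext => v; apply: eval_ext => w; case: v; case: w.
have et f : eval t f = eval b (fun v => eval c (fun w =>
    \sum_(bx <- Box u z k :: bxs) G f v w bx)).
  rewrite (@eval_add p.+1) //; last exact: ht_grow.
  rewrite eval_grow evN IHe -evalD; apply: eval_ext => v.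
  by rewrite -evalD; apply: eval_ext => w; rewrite big_cons.
have emp f : is_nil (pick u b) || is_nil (child z c) -> eval rest f = eval t f.
  move=> nil; rewrite (@eval_add p.+1) //; last exact: ht_grow.
  rewrite eval_grow en; case/orP: nil => /is_nilP->; first by [].
  rewrite [X in X + _](_ : _ = 0) // -[RHS](eval0 (pick u b)).
  exact: eval_ext.
rewrite /= -/rest; case: (boolP (is_nil (child z c))) => nc.
  by split=> // f; rewrite emp ?nc ?orbT.
by case: (boolP (is_nil (pick u b))) => nb; split=> // f; rewrite ?emp ?nb.
Qed.

Lemma count_edge_kernel step K d D y z v w :
  count (all2 fits (d :: D)) (edge_kernel step K (y :: v) (z :: w)) =
  if allows (step y z) d then count (all2 fits D) (K v w) else 0.
Proof.
rewrite /edge_kernel; case: (step y z) => [k|] //=; rewrite count_map.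
case: ifP => dk; first by apply: eq_count => u /=; rewrite dk.
by elim: (K v w) => //= u us ->; rewrite dk.
Qed.

Lemma eval_wsums m n p (starts : seq (letter * N)) b c
    (next : letter -> tree -> tree -> tree) K :
    (forall x, x \in [seq xm.1 | xm <- starts] -> yields m n p (next x) (K x)) ->
    ht m b -> ht n c ->
  ht p (wsums starts c (fun x => next x b)) /\
  forall f, eval (wsums starts c (fun x => next x b)) f =
    \sum_(xm <- starts) nat_of_bin xm.2 * eval b (fun v => eval c (fun w =>
      \sum_(u <- K xm.1 v w) f u)).
Proof.
move=> yK hb hc; elim: starts yK => [|[x k] starts IH] yK /=.
  by split=> // f; rewrite big_nil.
have [y sy|IHh IHe] := IH; first by apply: yK; rewrite inE sy orbT.
have hc' : ht n (weigh k c) by rewrite ht_weigh.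
have [hx ex] := yK x (mem_head _ _) b _ hb hc'.
split=> [|f]; first exact: ht_add.
rewrite (eval_add _ hx IHh) big_cons IHe ex /= -evalM; congr (_ + _).
by apply: eval_ext => v; rewrite eval_weigh.
Qed.

(** * Solutions on the 4-cube, and half links *)

(** The edges of the 3-cube on the directions 0, 1, 2 are numbered in the order
    0|-, 1|-, 0|1, 1|0, 2|-, 0|2, 2|0, 1|2, 2|1, 0|12, 1|02, 2|01, where i|L has
    direction i and lower end L, and its squares in the order 01|-, 01|2, 02|-,
    02|1, 12|-, 12|0. Each square ij|L is given with its edges i|L, i|jL, j|L,
    j|iL. *)
Definition square_edges : seq (seq nat) :=
  [:: [:: 0; 2; 1; 3]; [:: 5; 9; 7; 10]; [:: 0; 5; 4; 6];
      [:: 2; 9; 8; 11]; [:: 1; 7; 4; 8]; [:: 3; 10; 6; 11]].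

(** The squares in the order used by [turns]. *)
Definition cube_squares : seq nat := [:: 4; 5; 2; 3; 0; 1].

Definition shift (k : nat) (idx : seq nat) : seq nat := [seq k + i | i <- idx].

Definition squares (top side : nat) : seq (seq nat) :=
  [seq top + i :: shift side (nth [::] square_edges i) | i <- iota 0 6].

(** In the 4-cube, the squares 0, ..., 11 lie over the edges of the 3-cube on the
    directions 0, 1, 2, and its squares reappear as 12, ..., 17 at the bottom and as
    18, ..., 23 at the top of direction 3. The eight 3-faces are the bottom, the
    top and one over each square. *)
Definition slice_cells : seq (seq nat) :=
  shift 12 cube_squares :: shift 18 cube_squares ::
  [seq 12 + i :: 18 + i :: nth [::] square_edges i | i <- iota 0 6].

Definition slice_ok (T : class_table) (w : seq letter) : bool :=
  all (fun idx => obeys T (entries w idx)) slice_cells.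

Definition classes (T : class_table) (sqs : seq (seq nat)) (w : seq letter) :
    seq (option letter) := [seq class_at T (entries w idx) | idx <- sqs].

Fixpoint line (ks : seq (option letter)) : tree :=
  match ks with
  | [::] => Leaf 1
  | Some k :: ks => One k (line ks)
  | None :: _ => Nil
  end.

Lemma eval_line ks f :
  eval (line ks) f = if all isSome ks then f (pmap id ks) else 0.
Proof.
by elim: ks f => [|[k|] ks IH] f //=; exact: mul1n.
Qed.

Lemma ht_line ks : ht (size ks) (line ks).
Proof. by elim: ks => [//|[k|] ks IH]. Qed.

Fixpoint select (ks : seq (option letter)) (t : tree) : tree :=
  match ks with
  | [::] => t
  | Some Any :: ks => branch [:: Mi; Ze; Pl] (fun x => select ks (child x t))
  | Some k :: ks => grow k (select ks (child k t))
  | None :: _ => Nil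
  end.

Lemma ht_select ks t : ht (size ks) t -> ht (size ks) (select ks t).
Proof.
elim: ks t => [//|[k|//] ks IH] t /= ht_t.
case: k; try by apply: ht_grow; apply: IH; apply: ht_child.
by apply: ht_branch => x; apply: IH; apply: ht_child.
Qed.

Lemma eval_select ks t f : ht (size ks) t ->
  eval (select ks t) f = eval t (fun w => if all2 allows ks w then f w else 0).
Proof.
elim: ks t f => [|[k|] ks IH] t f /= ht_t.
- by apply: (eq_eval ht_t) => -[].
- have hch x := ht_child x ht_t.
  have ch x g : eval (select ks (child x t)) g = eval t (guard
      (fun y => (x != Any) && (y == x)) (fun w => if all2 allows ks w then g w else 0)).
    by rewrite IH // eval_child.
  case: k; rewrite ?eval_grow; try by rewrite ch; apply: (eq_eval ht_t) => -[|[] w] //=;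
    case: (all2 _ _ _).
  rewrite (@eval_branch _ (size ks)); last by move=> x; apply: ht_select.
  rewrite !big_cons big_nil addn0 !ch -!evalD; apply: (eq_eval ht_t) => -[|[] w] //= _;
    by rewrite ?addn0 ?add0n; case: (all2 _ _ _).
- by rewrite -[LHS](eval0 t); apply: eval_ext => -[].
Qed.

Section Tries.

Variables (vals : seq letter) (T : class_table).

Definition defined (s : seq letter) : bool := isSome (class_at T s).

(** A condition on four side squares that follows from the existence of a class
    for some bottom square: it prunes the search before that square is reached. *)
Definition definable (e : seq letter) : bool := has (fun a => defined (a :: e)) vals.

Definition three_cubes : tree :=
  solve vals [seq due [:: (cube_squares, obeys T)] k | k <- iota 0 6]
    (fun=> Leaf 1) [::].

Definition slice_constraints : seq constraint :=
  (shift 12 cube_squares, obeys T)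
  :: [seq (idx, definable) | idx <- square_edges]
  ++ [seq (idx, defined) | idx <- squares 12 0].

(** Only the bottom and the vertical squares are searched for. The top squares are
    then a solution on the 3-cube in prescribed classes. *)
Definition slices : tree :=
  (* Bound outside of the abstraction, these are evaluated only once. *)
  let q := three_cubes in let sqs := squares 12 0 in
  solve vals [seq due slice_constraints k | k <- iota 0 18]
    (fun env => select (classes T sqs (rev env)) q) [::].

Definition side_constraints : seq constraint :=
  (cube_squares, obeys T) :: [seq (idx, defined) | idx <- squares 0 6].

(** One half of a link: the six squares q of a bottom or top 3-cube of the face A,
    followed by twelve link squares over its edges, followed by the classes that
    these impose on the opposite squares of D. *)
Definition sides : tree :=
  let sqs := squares 0 6 in
  solve vals [seq due side_constraints k | k <- iota 0 18]
    (fun env => line (classes T sqs (rev env))) [::].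

Lemma ht_three_cubes : ht 6 three_cubes.
Proof. exact: (@ht_solve vals 0 (fun=> Leaf 1) (fun=> isT) _ [::]). Qed.

Lemma eval_three_cubes f : eval three_cubes f =
  \sum_(w <- words vals 6) if obeys T (entries w cube_squares) then f w else 0.
Proof.
rewrite (@eval_solve vals 0) //; apply: eq_sum_words => w sw _.
by rewrite meets_all // /= andbT mul1n cats0.
Qed.

Lemma ht_sides : ht 24 sides.
Proof.
apply: (@ht_solve vals 6 _ _ [seq due side_constraints k | k <- iota 0 18] [::]) => env.
exact: (ht_line (classes T (squares 0 6) (rev env))).
Qed.

Lemma eval_sides f : eval sides f =
  \sum_(w <- words vals 18)
    if obeys T (entries w cube_squares) && all isSome (classes T (squares 0 6) w)
    then f (w ++ pmap id (classes T (squares 0 6) w)) else 0.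
Proof.
rewrite (@eval_solve vals 6); last first.
  by move=> env; apply: (ht_line (classes T (squares 0 6) (rev env))).
apply: eq_sum_words => w sw _; rewrite meets_all //.
rewrite eval_line catrevE cats0 revK.
have -> : all (holds w) side_constraints
    = obeys T (entries w cube_squares) && all isSome (classes T (squares 0 6) w).
  by rewrite /side_constraints [LHS]/= all_map.
by case: (obeys T _); case: (all isSome _).
Qed.

Lemma ht_slices : ht 24 slices.
Proof.
apply: (@ht_solve vals 6 _ _ [seq due slice_constraints k | k <- iota 0 18] [::]) => env.
exact: (@ht_select (classes T (squares 12 0) (rev env)) _ ht_three_cubes).
Qed.

Lemma all2_allows_defined ks w : all2 allows ks w -> all isSome ks.
Proof. by elim: ks w => [|[k|] ks IH] [|x w] //= /andP[_ /IH]. Qed.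

(** The constraints [definable] and [defined] that the search tests follow from
    [slice_ok]: whatever the top squares are, the classes to which they have to
    belong exist. *)
Lemma eval_slices f : eval slices f =
  \sum_(w <- words vals 24) if slice_ok T w then f w else 0.
Proof.
rewrite (@eval_solve vals 6); last first.
  by move=> env; apply: (@ht_select (classes T (squares 12 0) (rev env)) _ ht_three_cubes).
rewrite [RHS](@sum_words_cat vals 18 6); apply: eq_sum_words => u su vu.
rewrite meets_all // catrevE cats0 revK; set ks := classes _ _ _.
rewrite (@eval_select ks _ _ ht_three_cubes) eval_three_cubes.
transitivity (\sum_(v <- words vals 6) if [&& all (holds u) slice_constraints,
   obeys T (entries v cube_squares) & all2 allows ks v] then f (u ++ v) else 0).
  case: (all _ _); last by rewrite big1_eq.
  by apply: eq_bigr => v _; case: (obeys _ _).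
apply: eq_sum_words => v sv _; congr (if _ then _ else _).
have -> : slice_ok T (u ++ v) = [&& obeys T (entries u (shift 12 cube_squares)),
   obeys T (entries v cube_squares) & all2 allows ks v].
  rewrite /ks {ks}; move: u v su sv {vu} => u v.
  by do 19?[case: u => [|? u] //]; do 7?[case: v => [|? v] //].
have -> : all (holds u) slice_constraints =
    [&& obeys T (entries u (shift 12 cube_squares)),
        all (fun e => definable (entries u e)) square_edges
      & all (fun idx => defined (entries u idx)) (squares 12 0)].
  by rewrite /= !andbT !andbA.
case ok: (all2 allows ks v); last by rewrite !andbF.
have defd : all (fun idx => defined (entries u idx)) (squares 12 0).
  by have := all2_allows_defined ok; rewrite all_map.
rewrite defd !andbT; congr (_ && _); rewrite -[RHS]andbT; congr (_ && _).
apply/allP => e /(nthP [::])[i i6 <-].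
apply/hasP; exists (nth Ze u (12 + i)).
  move/allP: vu; apply; apply: mem_nth; rewrite su.
  by do 6?[case: i i6 => [|i] i6 //].
have := allP defd (12 + i :: shift 0 (nth [::] square_edges i)).
rewrite /= [shift 0 _](eq_map (g := id)) // map_id; apply.
by apply/mapP; exists i; rewrite ?mem_iota // [shift 0 _](eq_map (g := id)) // map_id.
Qed.

End Tries.

(** * Extensions from the 4-cube to the 5-cube *)

Fixpoint sub (q : seq letter) (t : tree) : tree :=
  if q is x :: q then sub q (child x t) else t.

Lemma ht_sub n q t : ht (size q + n) t -> ht n (sub q t).
Proof. by elim: q t => [//|x q IH] t /= ht_t; apply: IH; apply: ht_child. Qed.

Lemma eval_sub n q t f : Any \notin q -> ht (size q + n) t -> eval (sub q t) f =
  eval t (fun w => if take (size q) w == q then f (drop (size q) w) else 0).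
Proof.
elim: q t f => [|x q IH] t f /=.
  by move=> _ _; apply: eval_ext => w; rewrite take0 drop0.
rewrite inE negb_or eq_sym => /andP[nx nq] ht_t; rewrite IH ?ht_child // eval_child.
apply: (eq_eval ht_t) => -[|y w] //= _.
by rewrite nx /= eqseq_cons; case: (y == x).
Qed.

Arguments edge_kernel : simpl never.
Arguments sum_kernel : simpl never.
Arguments obeys : simpl never.
Arguments all2 : simpl never.
Arguments words : simpl never.

(** The vertices of the 3-cube are bit masks; edge i joins the two given ones. *)
Definition edge_ends : seq (nat * nat) :=
  [:: (0, 1); (0, 2); (2, 3); (1, 3); (0, 4); (4, 5); (1, 5); (4, 6); (2, 6);
      (6, 7); (5, 7); (3, 7)].

Lemma sum0 (I : Type) (r : seq I) F : (forall i, F i = 0) -> \sum_(i <- r) F i = 0.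
Proof. by move=> F0; rewrite big1. Qed.

Lemma sum_count (I : Type) (s : seq I) (p : pred I) : \sum_(i <- s) p i = count p s.
Proof. by elim: s => [|i s IH]; rewrite ?big_nil // big_cons IH. Qed.

Lemma all2_cat (r : rel letter) s1 s2 t1 t2 : size s1 = size t1 ->
  all2 r (s1 ++ s2) (t1 ++ t2) = all2 r s1 t1 && all2 r s2 t2.
Proof.
rewrite /all2; elim: s1 t1 => [|x s1 IH] [|y t1] //= [/IH->].
by rewrite andbA.
Qed.

Section Extensions.

Variables (vals : seq letter) (T : class_table) (X : box_table).
Variable starts : seq (letter * N).

(** A walk over the 3-cube on the directions 0, 1, 2 that fills a link. At every
    vertex v it chooses c_v = a_{34|v}. Along an edge e = i|L, both ends of which
    have been chosen, it consumes the letters B_e = a_{i4|L} and C_e = a_{i4|3L}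
    of the tries b and c: together with the square a_{i3|L} of A they determine the
    class of the square a_{i3|4L} of D. The order of the vertices is such that
    the edges are passed in the order of their numbers. In the end, what is left
    of the words in b and c are the classes at the other squares of D. *)
Definition climb_from (mids : seq letter) (c0 : letter) (b c : tree) : tree :=
  if mids is [:: a0; a1; a2; a3; a4; a5; a6; a7; a8; a9; a10; a11] then
    let x0 := get X a0 in let x1 := get X a1 in let x2 := get X a2 in
    let x3 := get X a3 in let x4 := get X a4 in let x5 := get X a5 in
    let x6 := get X a6 in let x7 := get X a7 in let x8 := get X a8 in
    let x9 := get X a9 in let x10 := get X a10 in let x11 := get X a11 in
    sums vals (fun c1 => edge x0 c0 c1 b c (fun b c =>
    sums vals (fun c2 => edge x1 c0 c2 b c (fun b c =>
    sums vals (fun c3 => edge x2 c2 c3 b c (fun b c => edge x3 c1 c3 b c (fun b c =>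
    sums vals (fun c4 => edge x4 c0 c4 b c (fun b c =>
    sums vals (fun c5 => edge x5 c4 c5 b c (fun b c => edge x6 c1 c5 b c (fun b c =>
    sums vals (fun c6 => edge x7 c4 c6 b c (fun b c => edge x8 c2 c6 b c (fun b c =>
    sums vals (fun c7 => edge x9 c6 c7 b c (fun b c => edge x10 c5 c7 b c (fun b c =>
      edge x11 c3 c7 b c graft))))))))))))))))))
  else Nil.

Definition climb (mids : seq letter) (b c : tree) : tree :=
  wsums starts c (fun c0 => climb_from mids c0 b).

(** B has to be compatible with the bottom of A and C with its top. *)
Definition patterns (W : tree) (A : seq letter) : tree :=
  climb (take 12 A) (sub (take 6 (drop 12 A)) W) (sub (drop 18 A) W).

Definition extensions (S W : tree) (A : seq letter) : N :=
  join 24 (patterns W A) S.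

Local Notation EK a c c' K := (edge_kernel (step_class vals T a c c') K).
Local Notation SK K := (sum_kernel vals K).

Definition climb_kernel (mids : seq letter) (c0 : letter) : kernel :=
  let a := nth Ze mids in
  SK (fun c1 => EK (a 0) c0 c1 (
  SK (fun c2 => EK (a 1) c0 c2 (
  SK (fun c3 => EK (a 2) c2 c3 (EK (a 3) c1 c3 (
  SK (fun c4 => EK (a 4) c0 c4 (
  SK (fun c5 => EK (a 5) c4 c5 (EK (a 6) c1 c5 (
  SK (fun c6 => EK (a 7) c4 c6 (EK (a 8) c2 c6 (
  SK (fun c7 => EK (a 9) c6 c7 (EK (a 10) c5 c7 (
    EK (a 11) c3 c7 (fun v w => [:: v ++ w]))))))))))))))))))).

Hypothesis okX : boxes_ok vals T X.
Hypothesis okstarts : all (mem vals) [seq xm.1 | xm <- starts].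

Lemma yields_edge m n p a c c' next K : a \in vals -> c \in vals -> c' \in vals ->
    yields m n p next K ->
  yields m.+1 n.+1 p.+1 (fun b d => edge (get X a) c c' b d next) (EK a c c' K).
Proof.
move=> va vc vc'; apply: yields_edges => y z.
have := okX => /allP/(_ _ va)/allP/(_ _ vc)/allP/(_ _ vc')/fourP/(_ y)/fourP/(_ z).
by move/eqP.
Qed.

(** Each edge is one step, and each vertex sums over the steps for its letters. *)
Lemma eval_climb mids b c : size mids = 12 -> all (mem vals) mids ->
    ht 18 b -> ht 18 c ->
  ht 24 (climb mids b c) /\
  forall f, eval (climb mids b c) f = \sum_(xm <- starts)
    nat_of_bin xm.2 * eval b (fun v => eval c (fun w =>
      \sum_(u <- climb_kernel mids xm.1 v w) f u)).
Proof.
do 13?[case: mids => [|? mids] //].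
move=> _ /and5P[v0 v1 v2 v3] /and5P[v4 v5 v6 v7] /and5P[v8 v9 v10 v11 _] hb hc.
apply: (@eval_wsums 18 18 24) => // c0 /(allP okstarts) u0.
rewrite /climb_from /climb_kernel /=.
do ![apply: yields_sums => ? ? | apply: yields_edge => //].
exact: (@yields_graft 6 6).
Qed.

Lemma count_EK a c c' K d D y z v w : y \in vals -> z \in vals ->
  count (all2 fits (d :: D)) (EK a c c' K (y :: v) (z :: w)) =
  if obeys T [:: a; d; y; z; c; c'] then count (all2 fits D) (K v w) else 0.
Proof. by move=> vy vz; rewrite count_edge_kernel /step_class vy vz. Qed.

Definition mids_ok (A D c B C : seq letter) : bool :=
  all (fun i => obeys T [:: nth Ze A i; nth Ze D i; nth Ze B i; nth Ze C i;
    nth Ze c (nth (0, 0) edge_ends i).1; nth Ze c (nth (0, 0) edge_ends i).2])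
  (iota 0 12).

(** One word D fits at most one of the patterns obtained from given B, C and c,
    and it does so when all the 3-faces over the edges obey the rule. *)
Lemma count_climb A D B C c0 D' b c : size A = 12 -> size D = 12 ->
    size B = 12 -> all (mem vals) B -> size C = 12 -> all (mem vals) C ->
  count (all2 fits (D ++ D')) (climb_kernel A c0 (B ++ b) (C ++ c)) =
  \sum_(u <- words vals 7)
    (mids_ok A D (c0 :: u) B C && all2 fits D' (b ++ c)).
Proof.
do 13?[case: A => [|? A] //] => _; do 13?[case: D => [|? D] //] => _.
do 13?[case: B => [|? B] //] => _ /and5P[vB0 vB1 vB2 vB3].
move=> /and5P[vB4 vB5 vB6 vB7] /and5P[vB8 vB9 vB10 vB11 _].
do 13?[case: C => [|? C] //] => _ /and5P[vC0 vC1 vC2 vC3].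
move=> /and5P[vC4 vC5 vC6 vC7] /and5P[vC8 vC9 vC10 vC11 _].
rewrite !sum_wordsS /climb_kernel !cat_cons cat0s /=.
do 12?[rewrite ?count_sum_kernel ?sum_wordsS; do ?[apply: eq_bigr => ? _];
  rewrite /= count_EK //; case: ifP => [?|E0];
  last by symmetry; do ?[apply: sum0 => ?]; rewrite /mids_ok /= E0 ?andbF].
rewrite sum_words0 /mids_ok /= addn0; congr (nat_of_bool _).
by repeat match goal with H : is_true (obeys _ _) |- _ => rewrite H {H} end.
Qed.

Definition bots_ok (A D B : seq letter) : bool :=
  all (fun i => obeys T (nth Ze A (12 + i) :: nth Ze D (12 + i)
                         :: entries B (nth [::] square_edges i))) (iota 0 6).

Definition tops_ok (A D C : seq letter) : bool :=
  all (fun i => obeys T (nth Ze A (18 + i) :: nth Ze D (18 + i)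
                         :: entries C (nth [::] square_edges i))) (iota 0 6).

Lemma all2_fits_classes D ks : size D = size ks ->
  all isSome ks && all2 fits D (pmap id ks) = all2 (fun d o => allows o d) D ks.
Proof.
rewrite /all2; elim: ks D => [|[k|] ks IH] [|d D] //= [/IH<-].
by rewrite andbCA.
Qed.

Hypotheses (uniq_vals : uniq vals) (vals_proper : Any \notin vals).

Lemma eval_side q f : size q = 6 -> all (mem vals) q ->
    obeys T (entries q cube_squares) ->
  eval (sub q (sides vals T)) f = \sum_(B <- words vals 12)
    if all isSome (classes T (squares 0 6) (q ++ B))
    then f (B ++ pmap id (classes T (squares 0 6) (q ++ B))) else 0.
Proof.
move=> sq vq okq; rewrite (@eval_sub 18) ?sq; last first.
- exact: ht_sides.
- by apply: contra vals_proper => /(allP vq).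
rewrite eval_sides (@sum_words_cat vals 6 12).
have pick_q (F : seq letter -> nat) : (forall q', size q' = 6 -> q' != q -> F q' = 0) ->
    \sum_(q' <- words vals 6) F q' = F q.
  move=> F0; rewrite (bigD1_seq q) ?mem_words ?sq ?vq ?uniq_words //=.
  rewrite big_seq_cond big1 ?addn0 // => q' /andP[].
  by rewrite mem_words => /andP[/eqP sq' _]; apply: F0.
rewrite pick_q => [|q' sq' nq]; last first.
  apply: sum0 => B; rewrite -catA take_size_cat // (negPf nq).
  by case: (_ && _).
apply: eq_sum_words => B sB vB.
have -> : entries (q ++ B) cube_squares = entries q cube_squares.
  by rewrite /entries /= !nth_cat sq.
by rewrite okq /= -catA take_size_cat // eqxx drop_size_cat.
Qed.

Lemma bot_classes A D B : size A = 24 -> size D = 24 ->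
  all2 (fun d o => allows o d) (take 6 (drop 12 D))
    (classes T (squares 0 6) (take 6 (drop 12 A) ++ B)) = bots_ok A D B.
Proof.
by do 25?[case: A => [|? A] //]; do 25?[case: D => [|? D] //].
Qed.

Lemma top_classes A D C : size A = 24 -> size D = 24 ->
  all2 (fun d o => allows o d) (drop 18 D)
    (classes T (squares 0 6) (drop 18 A ++ C)) = tops_ok A D C.
Proof.
by do 25?[case: A => [|? A] //]; do 25?[case: D => [|? D] //].
Qed.

Definition link_ok A D c B C : bool :=
  [&& mids_ok A D c B C, bots_ok A D B & tops_ok A D C].

Lemma mids_ok_take A D c B C :
  mids_ok (take 12 A) (take 12 D) c B C = mids_ok A D c B C.
Proof.
apply: eq_in_all => i; rewrite mem_iota => /andP[_ i12].
by rewrite !nth_take.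
Qed.

Lemma size_pmap_classes (ks : seq (option letter)) :
  all isSome ks -> size (pmap id ks) = size ks.
Proof. by elim: ks => [|[k|] ks IH] //= /IH->. Qed.

(** The extensions of A to the 5-cube in which a_{34|-} has the letter c0. *)
Definition extension_count (A : seq letter) (c0 : letter) : nat :=
  \sum_(D <- words vals 24) if slice_ok T D then
    \sum_(B <- words vals 12) \sum_(C <- words vals 12)
      \sum_(u <- words vals 7) link_ok A D (c0 :: u) B C else 0.

(** The pairs of a pattern and a fitting D are summed over D first; for a given D,
    the patterns that it fits correspond to the links that make a solution of A
    and D. *)
Lemma extensionsE A : size A = 24 -> all (mem vals) A ->
    obeys T (entries A (shift 12 cube_squares)) ->
    obeys T (entries A (shift 18 cube_squares)) ->
  nat_of_bin (extensions (slices vals T) (sides vals T) A) =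
  \sum_(xm <- starts) xm.2 * extension_count A xm.1.
Proof.
move=> sA vA okb okt.
have sb : size (take 6 (drop 12 A)) = 6 by rewrite size_take size_drop sA.
have st : size (drop 18 A) = 6 by rewrite size_drop sA.
have vb : all (mem vals) (take 6 (drop 12 A)).
  by apply/allP => x /mem_take/mem_drop; apply: (allP vA).
have vt : all (mem vals) (drop 18 A) by apply/allP => x /mem_drop; apply: (allP vA).
have okb' : obeys T (entries (take 6 (drop 12 A)) cube_squares).
  by rewrite /entries /= !nth_take // !nth_drop.
have okt' : obeys T (entries (drop 18 A) cube_squares) by rewrite /entries /= !nth_drop.
have hb : ht 18 (sub (take 6 (drop 12 A)) (sides vals T)).
  by apply: ht_sub; rewrite sb; apply: ht_sides.
have ht_t : ht 18 (sub (drop 18 A) (sides vals T)).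
  by apply: ht_sub; rewrite st; apply: ht_sides.
have sm : size (take 12 A) = 12 by rewrite size_take sA.
have vm : all (mem vals) (take 12 A) by apply/allP => x /mem_take; apply: (allP vA).
have [hp ep] := eval_climb sm vm hb ht_t.
rewrite /extensions joinE ?ht_slices // /pairing eval_swap eval_slices.
transitivity (\sum_(D <- words vals 24) \sum_(xm <- starts) xm.2 *
   if slice_ok T D then \sum_(B <- words vals 12) \sum_(C <- words vals 12)
      \sum_(u <- words vals 7) link_ok A D (xm.1 :: u) B C else 0); last first.
  rewrite exchange_big /=; apply: eq_bigr => xm _.
  by rewrite -big_distrr.
apply: eq_sum_words => D sD _; case: ifP => _; last by rewrite sum0 // => xm; rewrite muln0.
rewrite /patterns ep; apply: eq_bigr => -[c0 m] _; congr (_ * _).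
rewrite eval_side //; apply: eq_sum_words => B sB vB.
set kb := classes _ _ _.
transitivity (\sum_(C <- words vals 12) \sum_(u <- words vals 7)
   (all isSome kb && (all isSome (classes T (squares 0 6) (drop 18 A ++ C)) &&
    (mids_ok (take 12 A) (take 12 D) (c0 :: u) B C &&
      all2 fits (drop 12 D) (pmap id kb
        ++ pmap id (classes T (squares 0 6) (drop 18 A ++ C))))) : nat)).
  case: (all isSome kb); last by symmetry; do !apply: sum0 => ?.
  rewrite eval_side //; apply: eq_sum_words => C sC vC.
  case: (all isSome _); last by symmetry; apply: sum0.
  rewrite -(@count_climb _ (take 12 D)) //; last by rewrite size_takel ?sD.
  by rewrite cat_take_drop sum_count.
apply: eq_sum_words => C sC vC; apply: eq_sum_words => u _ _; congr (nat_of_bool _).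
set kt := classes _ _ _.
rewrite mids_ok_take /link_ok -(bot_classes B sA sD) -(top_classes C sA sD) -/kb -/kt.
rewrite -!all2_fits_classes ?size_drop ?size_takel ?size_drop ?sD //.
have D12 : drop 12 D = take 6 (drop 12 D) ++ drop 18 D.
  by rewrite (_ : drop 18 D = drop 6 (drop 12 D)) ?cat_take_drop // drop_drop.
case sk: (all isSome kb); last by rewrite !andbF.
rewrite [X in all2 fits X (_ ++ _)]D12 all2_cat; last first.
  by rewrite size_pmap_classes // size_takel // size_drop sD.
rewrite !andTb [LHS]andbCA; congr (_ && _).
by rewrite [LHS]andbCA.
Qed.

End Extensions.

(** * Flipping the signs of a link *)

Definition flip (x : letter) : letter :=
  match x with Mi => Pl | Pl => Mi | _ => x end.

Lemma flipK : involutive flip. Proof. by case. Qed.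

Lemma sum_words_flip vals n (F : seq letter -> nat) :
    perm_eq (map flip vals) vals ->
  \sum_(w <- words vals n) F (map flip w) = \sum_(w <- words vals n) F w.
Proof.
move=> fv; elim: n F => [|n IHn] F; first by rewrite !sum_words0.
rewrite !sum_wordsS -[RHS](perm_big _ fv) big_map /=.
by apply: eq_bigr => x _; rewrite -(IHn (fun w => F (flip x :: w))).
Qed.

Lemma nth_flip s i : nth Ze (map flip s) i = flip (nth Ze s i).
Proof. by elim: s i => [|x s IH] [|i] //=. Qed.

Lemma mem_nth_vals (vals : seq letter) n s i : size s = n -> all (mem vals) s -> i < n ->
  nth Ze s i \in vals.
Proof. by move=> <- vs lt_i; apply: (allP vs); apply: mem_nth. Qed.

Lemma all_iota_eq n (p q : pred nat) : (forall i, i < n -> p i = q i) ->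
  all p (iota 0 n) = all q (iota 0 n).
Proof. by move=> pq; apply: eq_in_all => i; rewrite mem_iota => /andP[_ /pq]. Qed.

Section Flips.

Variables (vals : seq letter) (T : class_table).

Hypothesis flip_vals : perm_eq (map flip vals) vals.
Hypothesis flip_T : forall a d b1 b2 b3 b4,
  all (mem vals) [:: a; d; b1; b2; b3; b4] ->
  obeys T [:: a; d; flip b1; flip b2; flip b3; flip b4] =
  obeys T [:: a; d; b1; b2; b3; b4].

(** All the side squares of the 3-faces between A and D belong to the link, so the
    invariance of the rule under a simultaneous change of their four signs
    suffices. *)
Lemma link_ok_flip A D c B C : size A = 24 -> all (mem vals) A ->
    size D = 24 -> all (mem vals) D -> size c = 8 -> all (mem vals) c ->
    size B = 12 -> all (mem vals) B -> size C = 12 -> all (mem vals) C ->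
  link_ok T A D (map flip c) (map flip B) (map flip C) = link_ok T A D c B C.
Proof.
move=> sA vA sD vD sc vc sB vB sC vC.
have mA i : i < 24 -> nth Ze A i \in vals.
  by apply: mem_nth_vals sA vA.
have mD i : i < 24 -> nth Ze D i \in vals.
  by apply: mem_nth_vals sD vD.
have mc i : i < 8 -> nth Ze c i \in vals.
  by apply: mem_nth_vals sc vc.
have mB i : i < 12 -> nth Ze B i \in vals.
  by apply: mem_nth_vals sB vB.
have mC i : i < 12 -> nth Ze C i \in vals.
  by apply: mem_nth_vals sC vC.
congr [&& _, _ & _]; apply: all_iota_eq => i i12.
- by do 12?[case: i i12 => [|i] i12 //]; rewrite /= !nth_flip flip_T //= ?mA ?mD ?mB ?mC ?mc.
- by do 6?[case: i i12 => [|i] i12 //]; rewrite /entries /= !nth_flip flip_T //= ?mA ?mD ?mB.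
- by do 6?[case: i i12 => [|i] i12 //]; rewrite /entries /= !nth_flip flip_T //= ?mA ?mD ?mC.
Qed.

Lemma extension_count_flip A x : size A = 24 -> all (mem vals) A -> x \in vals ->
  extension_count vals T A (flip x) = extension_count vals T A x.
Proof.
move=> sA vA vx; apply: eq_sum_words => D sD vD; case: ifP => // _.
have vfx : flip x \in vals.
  by rewrite -(perm_mem flip_vals) map_f.
rewrite -sum_words_flip //; apply: eq_sum_words => B sB vB.
rewrite -sum_words_flip //; apply: eq_sum_words => C sC vC.
rewrite -sum_words_flip //; apply: eq_sum_words => u su vu.
rewrite -[flip x :: _]/(map flip (x :: u)) link_ok_flip //= ?su //.
by rewrite vx.
Qed.

End Flips.

(** * The 5-cube *)

Lemma sum_words_split k m n vals (F : seq letter -> nat) : k = m + n ->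
  \sum_(w <- words vals k) F w =
  \sum_(u <- words vals m) \sum_(v <- words vals n) F (u ++ v).
Proof. by move=> ->; apply: sum_words_cat. Qed.

Lemma entries_cat u v idx : all (fun i => i < size u) idx ->
  entries (u ++ v) idx = entries u idx.
Proof.
by move/allP=> lt_idx; apply/eq_in_map => i /lt_idx; rewrite nth_cat => ->.
Qed.

Lemma nth_shift k (u v : seq letter) i : size u = k ->
  nth Ze (u ++ v) (k + i) = nth Ze v i.
Proof. by move=> <-; rewrite nth_cat ltnNge leq_addr addKn. Qed.

Lemma entries_shift k u v idx : size u = k ->
  entries (u ++ v) (shift k idx) = entries v idx.
Proof.
by move=> su; rewrite /entries -map_comp; apply: eq_map => i; apply: nth_shift.
Qed.

(** The 80 squares of the 5-cube are numbered as those of A, of D, the c_v, the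
    B_e and the C_e, in this order: A starts at 0, D at 24, c at 48, B at 56, C at
    68. *)
Definition link_cells : seq (seq nat) :=
  [seq [:: i; 24 + i; 56 + i; 68 + i; 48 + (nth (0, 0) edge_ends i).1;
           48 + (nth (0, 0) edge_ends i).2] | i <- iota 0 12] ++
  [seq 12 + i :: 36 + i :: shift 56 (nth [::] square_edges i) | i <- iota 0 6] ++
  [seq 18 + i :: 42 + i :: shift 68 (nth [::] square_edges i) | i <- iota 0 6].

Definition cubes5 : seq (seq nat) :=
  slice_cells ++ map (shift 24) slice_cells ++ link_cells.

Definition solution (rule : seq letter -> bool) (cubes : seq (seq nat)) (s : seq letter) :=
  all (fun idx => cube rule (entries s idx)) cubes.

Definition cells_ok (n : nat) (cubes : seq (seq nat)) : bool :=
  all (fun idx => (size idx == 6) && all (fun i => i < n) idx) cubes.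

Lemma solution_obeys vals rule T n cubes s : classes_ok vals rule T ->
    cells_ok n cubes -> size s = n -> all (mem vals) s ->
  solution rule cubes s = all (fun idx => obeys T (entries s idx)) cubes.
Proof.
move=> okT /allP okc sn vs; apply: eq_in_all => idx /okc /andP[/eqP s6 /allP lt_idx].
rewrite -(classes_okP okT) ?size_map //; apply/allP => _ /mapP[i /lt_idx lt_i ->].
by apply: (allP vs); rewrite mem_nth ?sn.
Qed.

Lemma solution5_cat vals rule T A D c B C : classes_ok vals rule T ->
    size A = 24 -> all (mem vals) A -> size D = 24 -> all (mem vals) D ->
    size c = 8 -> all (mem vals) c -> size B = 12 -> all (mem vals) B ->
    size C = 12 -> all (mem vals) C ->
  solution rule cubes5 (A ++ D ++ c ++ B ++ C) =
  [&& slice_ok T A, slice_ok T D & link_ok T A D c B C].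
Proof.
move=> okT sA vA sD vD sc vc sB vB sC vC.
rewrite (@solution_obeys vals _ T 80) //; first last.
- by rewrite !all_cat vA vD vc vB.
- by rewrite !size_cat sA sD sc sB sC.
set s := A ++ _; rewrite /cubes5 !all_cat.
have nA i : i < 24 -> nth Ze s i = nth Ze A i by rewrite nth_cat sA => ->.
have nD i : i < 24 -> nth Ze s (24 + i) = nth Ze D i.
  by rewrite nth_shift // nth_cat sD => ->.
have nc i : i < 8 -> nth Ze s (48 + i) = nth Ze c i.
  by rewrite /s catA nth_shift ?size_cat ?sA ?sD // nth_cat sc => ->.
have nB i : i < 12 -> nth Ze s (56 + i) = nth Ze B i.
  by rewrite /s 2!catA nth_shift ?size_cat ?sA ?sD ?sc // nth_cat sB => ->.
have nC i : nth Ze s (68 + i) = nth Ze C i.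
  by rewrite /s 3!catA nth_shift // !size_cat sA sD sc sB.
congr [&& _, _, _, _ & _].
- by apply: eq_in_all => idx idxS; rewrite entries_cat // sA; move: idx idxS; apply/allP.
- rewrite all_map; apply: eq_in_all => idx idxS /=; rewrite entries_shift // entries_cat // sD.
  by move: idx idxS; apply/allP.
- rewrite all_map; apply: all_iota_eq => i i12; congr (obeys T _).
  have [lt1 lt2] : (nth (0, 0) edge_ends i).1 < 8 /\ (nth (0, 0) edge_ends i).2 < 8.
    by move: i i12; do 12?[case=> //].
  have i24 : i < 24 by apply: ltn_trans i12 _.
  by rewrite /entries !map_cons nA // nD // nB // nC !nc //.
- rewrite all_map; apply: all_iota_eq => i i6; congr (obeys T _).
  rewrite /entries 2!map_cons nA ?(ltn_add2l 12 i 12) ?(ltn_trans i6) //.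
  rewrite -[36]/(24 + 12) -addnA nD ?(ltn_add2l 12 i 12) ?(ltn_trans i6) //.
  congr [:: _, _ & _]; rewrite -map_comp; apply/eq_in_map => j jS /=; rewrite nB //.
  have: all (all (fun j => j < 12)) square_edges by [].
  by move/(all_nthP [::])/(_ i i6)/allP; apply.
- rewrite all_map; apply: all_iota_eq => i i6; congr (obeys T _).
  rewrite /entries 2!map_cons nA ?(ltn_add2l 18 i 6) //.
  rewrite -[42]/(24 + 18) -addnA nD ?(ltn_add2l 18 i 6) //.
  by congr [:: _, _ & _]; rewrite -map_comp; apply: eq_map => j /=; rewrite nC.
Qed.

Definition restcount vals rule A : nat :=
  \sum_(r <- words vals 56) solution rule cubes5 (A ++ r).

Lemma restcountE vals rule T A : classes_ok vals rule T ->
    size A = 24 -> all (mem vals) A ->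
  restcount vals rule A =
  if slice_ok T A then \sum_(x <- vals) extension_count vals T A x else 0.
Proof.
move=> okT sA vA.
transitivity (\sum_(D <- words vals 24) \sum_(c <- words vals 8)
  \sum_(B <- words vals 12) \sum_(C <- words vals 12)
    [&& slice_ok T A, slice_ok T D & link_ok T A D c B C] : nat).
  rewrite /restcount [LHS](@sum_words_split 56 24 32 _ _ erefl); apply: eq_sum_words => D sD vD.
  rewrite [LHS](@sum_words_split 32 8 24 _ _ erefl); apply: eq_sum_words => c sc vc.
  rewrite [LHS](@sum_words_split 24 12 12 _ _ erefl); apply: eq_sum_words => B sB vB.
  by apply: eq_sum_words => C sC vC; rewrite (solution5_cat okT).
case: (slice_ok T A); last by do 4![apply: sum0 => ?].
rewrite /extension_count [RHS]exchange_big; apply: eq_sum_words => D sD vD.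
rewrite [LHS](@sum_words_split 8 1 7 _ _ erefl) sum_wordsS; apply: eq_bigr => x _.
rewrite sum_words0; case: (slice_ok T D); last by do 3![apply: sum0 => ?].
rewrite exchange_big; apply: eq_sum_words => B sB vB.
by rewrite exchange_big.
Qed.

Lemma count_solution5 vals rule T : classes_ok vals rule T ->
  count (solution rule cubes5) (words vals 80) =
  eval (slices vals T) (restcount vals rule).
Proof.
move=> okT; rewrite -sum_count [LHS](@sum_words_split 80 24 56 _ _ erefl) eval_slices.
apply: eq_sum_words => A sA vA; rewrite -/(restcount _ _ _) (restcountE okT) //.
by case: ifP.
Qed.

(** * Symmetries of the 5-cube *)

Inductive move := Relabel of seq nat | Reflect of bitseq.

Definition reflect_word (bs : bitseq) (s : seq letter) : seq letter :=
  [seq if bx.1 then flip bx.2 else bx.2 | bx <- zip bs s].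

Definition act (g : move) (s : seq letter) : seq letter :=
  match g with Relabel m => entries s m | Reflect bs => reflect_word bs s end.

Definition cut (n : nat) (g : move) : move :=
  match g with Relabel m => Relabel (take n m) | Reflect bs => Reflect (take n bs) end.

Definition involution (n : nat) (m : seq nat) : bool :=
  [&& size m == n, all (fun i => i < n) m & [seq nth 0 m i | i <- m] == iota 0 n].

(** Negating all a_{ij|K} with a fixed i changes the signs of two of the three
    pairs of opposite squares in each 3-face with direction i, and no sign in
    the other 3-faces. *)
Definition even_patterns : seq bitseq :=
  [:: [:: false; false; false; false; false; false];
      [:: true; true; true; true; false; false];
      [:: true; true; false; false; true; true];
      [:: false; false; true; true; true; true]].

Definition relabel_ok (m : seq nat) : bool :=
  [&& involution 80 m, involution 24 (take 24 m)
    & all (fun idx => [seq nth 0 m i | i <- idx] \in flatten (map (@turns nat) cubes5)) cubes5].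

Definition reflect_ok (bs : bitseq) : bool :=
  (size bs == 80) &&
  all (fun idx => [seq nth false bs i | i <- idx] \in even_patterns) cubes5.

Definition flips_ok (vals : seq letter) (rule : seq letter -> bool) : bool :=
  perm_eq (map flip vals) vals &&
  all (fun bs => all (fun s => cube rule s ==> cube rule (reflect_word bs s))
                     (words vals 6)) even_patterns.

Lemma entriesE s m idx : all (fun i => i < size m) idx ->
  entries (entries s m) idx = entries s [seq nth 0 m i | i <- idx].
Proof.
move/allP=> lt_idx; rewrite /entries -map_comp; apply/eq_in_map => i /lt_idx lt_i /=.
by rewrite (nth_map 0).
Qed.

Lemma entries_iota s : entries s (iota 0 (size s)) = s.
Proof. by rewrite /entries map_nth_iota0 // take_size. Qed.

Lemma involutionK n m s : involution n m -> size s = n -> entries (entries s m) m = s.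
Proof.
case/and3P=> /eqP sm lt_m /eqP mK sn; rewrite entriesE ?sm // mK -sn.
exact: entries_iota.
Qed.

Lemma size_reflect bs s : size bs = size s -> size (reflect_word bs s) = size s.
Proof. by move=> sb; rewrite size_map size_zip sb minnn. Qed.

Lemma reflectK bs s : size bs = size s -> reflect_word bs (reflect_word bs s) = s.
Proof.
rewrite /reflect_word; elim: bs s => [|b bs IH] [|x s] //= [/IH->].
by case: b => //; rewrite flipK.
Qed.

Lemma take_reflect n bs A r : size A = n ->
  take n (reflect_word bs (A ++ r)) = reflect_word (take n bs) A.
Proof.
move=> <-; rewrite /reflect_word; elim: A bs => [|x A IH] [|b bs]; rewrite /= ?take0 //.
by rewrite IH.
Qed.

Lemma entries_reflect bs s idx : size bs = size s -> all (fun i => i < size s) idx ->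
  entries (reflect_word bs s) idx =
  reflect_word [seq nth false bs i | i <- idx] (entries s idx).
Proof.
move=> sb /allP lt_idx; rewrite /reflect_word /entries zip_map -map_comp.
apply/eq_in_map => i /lt_idx lt_i /=.
by rewrite (nth_map (false, Ze)) ?size_zip ?sb ?minnn // nth_zip.
Qed.

Section Moves.

Variables (vals : seq letter) (rule : seq letter -> bool).

Definition symmetry (h : seq letter -> seq letter) := forall A,
  A \in words vals 24 ->
  h A \in words vals 24 /\ restcount vals rule (h A) = restcount vals rule A.

Lemma cubes5_bound idx : idx \in cubes5 -> all (fun i => i < 80) idx.
Proof. by move: idx; apply/allP. Qed.

Lemma cubes5_size idx : idx \in cubes5 -> size idx = 6.
Proof.
have /allP ok : all (fun idx : seq nat => size idx == 6) cubes5 by [].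
by move/ok/eqP.
Qed.

(** If g acts on the solutions and h is its effect on the face A, then g maps the
    extensions of A injectively to those of h A. As h is an involution, there
    are equally many. *)
Lemma symmetry_restrict (g h : seq letter -> seq letter) :
    (forall s, s \in words vals 80 -> g s \in words vals 80 /\ g (g s) = s) ->
    (forall s, s \in words vals 80 ->
       solution rule cubes5 s -> solution rule cubes5 (g s)) ->
    (forall A, A \in words vals 24 -> h A \in words vals 24 /\ h (h A) = A) ->
    (forall A r, A \in words vals 24 -> r \in words vals 56 -> take 24 (g (A ++ r)) = h A) ->
  uniq vals -> symmetry h.
Proof.
move=> gW gsol hW gh uv A WA; split; first by case: (hW A WA).
suff le A' : A' \in words vals 24 -> restcount vals rule A' <= restcount vals rule (h A').
  have [WhA hK] := hW A WA.
  by apply/eqP; rewrite eqn_leq le // andbT -[leqRHS](congr1 (restcount vals rule) hK) le.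
move=> {A}{}WA; rewrite /restcount !sum_count -!size_filter.
set r1 := filter _ _; set r2 := filter _ _.
have catW r : r \in words vals 56 -> A' ++ r \in words vals 80.
  move: WA; rewrite !mem_words size_cat all_cat => /andP[/eqP-> ->] /andP[/eqP-> ->].
  by [].
have gE r : r \in words vals 56 -> g (A' ++ r) = h A' ++ drop 24 (g (A' ++ r)).
  by move=> Wr; rewrite -(gh A' r) // cat_take_drop.
rewrite -(size_map (fun r => drop 24 (g (A' ++ r))) r1); apply: uniq_leq_size.
  rewrite map_inj_in_uniq ?filter_uniq ?uniq_words //.
  move=> r r'; rewrite !mem_filter => /andP[_ Wr] /andP[_ Wr'] e.
  have : g (A' ++ r) = g (A' ++ r') by rewrite gE // e -gE.
  move/(congr1 g); rewrite !(gW _ (catW _ _)).2 // => /eqP.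
  by rewrite eqseq_cat // eqxx => /eqP.
move=> _ /mapP[r + ->]; rewrite mem_filter => /andP[sol_r Wr].
rewrite mem_filter -gE; last exact: Wr.
rewrite gsol; [|exact: catW|exact: sol_r].
rewrite andTb.
have := (gW _ (catW _ Wr)).1; rewrite !mem_words size_drop => /andP[/eqP-> vg].
by apply/allP => x /mem_drop; apply: (allP vg).
Qed.

Lemma entries_words m n s : involution n m -> s \in words vals n ->
  entries s m \in words vals n.
Proof.
case/and3P=> /eqP sm /allP lt_m _; rewrite !mem_words size_map sm eqxx /=.
case/andP=> /eqP sn /allP vs; apply/allP => _ /mapP[i /lt_m lt_i ->].
by apply: vs; rewrite mem_nth ?sn.
Qed.

Lemma symmetry_relabel m : uniq vals -> relabel_ok m -> symmetry (act (Relabel (take 24 m))).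
Proof.
move=> uv /and3P[inv80 inv24 /allP okc].
have sm : size m = 80 by case/and3P: inv80 => /eqP.
apply: (@symmetry_restrict (fun s => entries s m)) => // [s Ws|s Ws /allP sol_s|A WA|A r WA Wr].
- split; first exact: entries_words.
  by apply: involutionK inv80 _; move: Ws; rewrite mem_words => /andP[/eqP].
- apply/allP => idx idxS; rewrite entriesE ?sm ?cubes5_bound //.
  have /flattenP[_ /mapP[idx' idxS' ->] turn] := okc _ idxS.
  rewrite (@cube_turns rule (entries s idx')); first exact: sol_s.
  by rewrite /entries map_turns map_f.
- split; first exact: entries_words.
  by apply: involutionK inv24 _; move: WA; rewrite mem_words => /andP[/eqP].
rewrite /entries -map_take; apply/eq_in_map => i.
case/and3P: inv24 => _ /allP lt_i _ /lt_i; rewrite nth_cat.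
by move: WA; rewrite mem_words => /andP[/eqP-> _ ->].
Qed.

Lemma reflect_words n bs s : perm_eq (map flip vals) vals -> size bs = n ->
  s \in words vals n -> reflect_word bs s \in words vals n.
Proof.
move=> fv sb; rewrite !mem_words => /andP[/eqP sn /allP vs].
rewrite size_reflect ?sb ?sn // eqxx /=; apply/allP => _ /mapP[[b x] bx ->] /=.
have vx : x \in vals.
  apply: vs; rewrite -(@unzip2_zip _ _ bs s) ?sb ?sn //.
  by apply/mapP; exists (b, x).
by case: b {bx} => //; rewrite -[_ \in _](perm_mem fv) map_f.
Qed.

Lemma symmetry_reflect bs : uniq vals -> flips_ok vals rule -> reflect_ok bs ->
  symmetry (act (Reflect (take 24 bs))).
Proof.
move=> uv /andP[fv /allP okp] /andP[/eqP sb /allP okc].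
have sz n s : s \in words vals n -> size s = n by rewrite mem_words => /andP[/eqP].
have s24 : size (take 24 bs) = 24 by rewrite size_take sb.
apply: (@symmetry_restrict (reflect_word bs)) => // [s Ws|s Ws /allP sol_s|A WA|A r WA Wr].
- by split; [apply: reflect_words | apply: reflectK; rewrite sb (sz _ _ Ws)].
- apply/allP => idx idxS; rewrite entries_reflect ?sb ?(sz _ _ Ws) ?cubes5_bound //.
  have imp := allP (okp _ (okc _ idxS)) (entries s idx).
  apply: (implyP (imp _)); last exact: sol_s.
  rewrite mem_words size_map cubes5_size //=; apply/allP => _ /mapP[i idx_i ->].
  move: Ws; rewrite mem_words => /andP[/eqP s80 /allP vs].
  by apply: vs; rewrite mem_nth // s80; apply: (allP (cubes5_bound idxS)).
- by split; [apply: reflect_words | apply: reflectK; rewrite s24 (sz _ _ WA)].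
by rewrite take_reflect // (sz _ _ WA).
Qed.

Definition move_ok (g : move) : bool :=
  match g with
  | Relabel m => relabel_ok m
  | Reflect bs => flips_ok vals rule && reflect_ok bs
  end.

Lemma symmetry_move g : uniq vals -> move_ok g -> symmetry (act (cut 24 g)).
Proof.
move=> uv; case: g => [m|bs] /=; first exact: symmetry_relabel.
by case/andP=> okf okb; apply: symmetry_reflect.
Qed.

End Moves.

(** The orbit under the products of moves, one from each level or none. *)
Definition orbit (gs : seq (seq move)) (A : seq letter) : seq (seq letter) :=
  foldl (fun L hs => L ++ flatten [seq map (act h) L | h <- hs]) [:: A] gs.

Lemma orbitP vals rule gs A : uniq vals -> all (all (move_ok vals rule)) gs ->
    A \in words vals 24 -> forall w, w \in orbit (map (map (cut 24)) gs) A ->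
  restcount vals rule w = restcount vals rule A.
Proof.
move=> uv ok WA w; pose good w := (w \in words vals 24) /\
  restcount vals rule w = restcount vals rule A.
suff: forall L, (forall w, w \in L -> good w) ->
    w \in foldl (fun L hs => L ++ flatten [seq map (act h) L | h <- hs]) L
            (map (map (cut 24)) gs) -> good w.
  by move=> gd /(gd [:: A])[] // w'; rewrite inE => /eqP->.
elim: gs ok => [_ L|hs gs IH /andP[okh okg] L gL] /=; first exact.
apply: IH => // {}w; rewrite mem_cat => /orP[/gL //|].
elim: hs okh => [//|h hs IHs] /= /andP[ok_h okhs]; rewrite mem_cat.
case/orP=> [/mapP[v /gL[Wv Rv] ->]|]; last exact: IHs.
by have [? Rh] := symmetry_move uv ok_h Wv; split; rewrite ?Rh.
Qed.

(** * Sweeping a trie orbit by orbit *)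

Fixpoint first (t : tree) : option (seq letter) :=
  match t with
  | Nil => None
  | Leaf _ => Some [::]
  | One k t => omap (cons k) (first t)
  | Node a b c d =>
    if first a is Some w then Some (Mi :: w) else
    if first b is Some w then Some (Ze :: w) else
    if first c is Some w then Some (Pl :: w) else omap (cons Any) (first d)
  end.

Lemma eval_first0 t f : first t = None -> eval t f = 0.
Proof.
elim: t f => [|m|k t IHt|a IHa b IHb c IHc d IHd] f //=.
  by case: (first t) IHt => // IHt _; apply: IHt.
case: (first a) IHa => // IHa; case: (first b) IHb => // IHb.
case: (first c) IHc => // IHc; case: (first d) IHd => // IHd _.
by rewrite IHa // IHb // IHc // IHd.
Qed.

Definition prune (a b c d : tree) : tree :=
  match a, b, c, d with Nil, Nil, Nil, Nil => Nil | _, _, _, _ => Node a b c d end.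

Lemma eval_prune a b c d f : eval (prune a b c d) f = eval (Node a b c d) f.
Proof. by case: a => //; case: b => //; case: c => //; case: d. Qed.

Fixpoint remove (w : seq letter) (t : tree) {struct w} : N * tree :=
  match w, t with
  | [::], Leaf m => (m, Nil)
  | Mi :: w, One Mi t => let: (m, t') := remove w t in (m, grow Mi t')
  | Ze :: w, One Ze t => let: (m, t') := remove w t in (m, grow Ze t')
  | Pl :: w, One Pl t => let: (m, t') := remove w t in (m, grow Pl t')
  | Mi :: w, Node a b c d => let: (m, a') := remove w a in (m, prune a' b c d)
  | Ze :: w, Node a b c d => let: (m, b') := remove w b in (m, prune a b' c d)
  | Pl :: w, Node a b c d => let: (m, c') := remove w c in (m, prune a b c' d)
  | _, _ => (0%num, t)
  end.

Lemma eval_remove w t f :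
  eval t f = (remove w t).1 * f w + eval (remove w t).2 f.
Proof.
elim: w t f => [|x w IH] [|m|k t|a b c d] f //=.
- by rewrite addn0.
- by case: x.
- by case: x.
- have := IH t (fun w => f (k :: w)).
  by case: x; case: k => //; case: (remove w t) => m t' /= ->; rewrite eval_grow.
case: x => /=.
- have := IH a (fun w => f (Mi :: w)); case: (remove w a) => m t /= ->.
  by rewrite eval_prune /= !addnA.
- have := IH b (fun w => f (Ze :: w)); case: (remove w b) => m t /= ->.
  by rewrite eval_prune /= addnCA !addnA.
- have := IH c (fun w => f (Pl :: w)); case: (remove w c) => m t /= ->.
  by rewrite eval_prune /= addnCA !addnA.
by [].
Qed.

Fixpoint remove_all (ws : seq (seq letter)) (t : tree) : N * tree :=
  if ws is w :: ws then
    let: (m, t) := remove w t in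
    let: (n, t) := remove_all ws t in (N.add m n, t)
  else (0%num, t).

Lemma eval_remove_all ws t f x : (forall w, w \in ws -> f w = x) ->
  eval t f = (remove_all ws t).1 * x + eval (remove_all ws t).2 f.
Proof.
elim: ws t => [//|w ws IH] t fx /=.
have := eval_remove w t f; case: (remove w t) => m t1 /= ->.
rewrite fx ?mem_head // (IH t1) => [|v v_ws]; last by rewrite fx // inE v_ws orbT.
by case: (remove_all ws t1) => n t2 /=; rewrite nat_of_binD mulnDl addnA.
Qed.

(** The identity in x. A lazy evaluator has to compute all digits of p before it
    turns to x; otherwise the sum below would be carried along as an unevaluated
    expression, together with all the tries in it. *)
Fixpoint forcing (A : Type) (p : positive) (x : A) : A :=
  match p with xI p | xO p => forcing p x | xH => x end.

Lemma forcingE (A : Type) p (x : A) : forcing p x = x.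
Proof. by elim: p. Qed.

(** The sum of a function that is constant on orbits: as long as some word is
    left, its orbit is removed and accounted for by a single value. *)
Fixpoint sweep (orb : seq letter -> seq (seq letter)) (val : seq letter -> option N)
    (fuel : nat) (t : tree) (acc : N) : option N :=
  match first t, fuel with
  | None, _ => Some acc
  | Some A, fuel.+1 =>
    if val A is Some r then
      let: (m, t) := remove_all (orb A) t in
      if N.add acc (N.mul m r) is Npos p
      then forcing p (sweep orb val fuel t (Npos p))
      else sweep orb val fuel t 0%num
    else None
  | Some _, 0 => None
  end.

Lemma sweepE (f : seq letter -> nat) orb (val : seq letter -> option N) fuel t acc s :
    (forall A (r : N), val A = Some r ->
       f A = r /\ forall w, w \in orb A -> f w = f A) ->
  sweep orb val fuel t acc = Some s -> acc + eval t f = s.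
Proof.
move=> fval; elim: fuel t acc s => [|fuel IH] t acc s /=; case ft: (first t) => [A|] //;
  try by case=> <-; rewrite eval_first0 // addn0.
case v: (val A) => [r|] //; have [fA orbA] := fval _ _ v.
rewrite (eval_remove_all t orbA); case: (remove_all _ t) => m t' /=.
rewrite addnA fA -nat_of_binM -nat_of_binD.
by case: (N.add acc _) => [|p]; rewrite ?forcingE; apply: IH.
Qed.

Fixpoint weight (t : tree) : N :=
  match t with
  | Nil => 0
  | Leaf m => m
  | One _ t => weight t
  | Node a b c d => N.add (N.add (weight a) (weight b)) (N.add (weight c) (weight d))
  end.

Lemma weightE t : nat_of_bin (weight t) = eval t (fun=> 1).
Proof.
elim: t => [|m|k t IHt|a IHa b IHb c IHc d IHd] //=; first by rewrite muln1.
by rewrite !nat_of_binD IHa IHb IHc IHd addnA.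
Qed.

Section Count.

Variables (vals : seq letter) (rule : seq letter -> bool).
Variables (T : class_table) (X : box_table) (starts : seq (letter * N)).
Variable gs : seq (seq move).

(** The walk may start with the letters and multiplicities in starts instead of
    every letter once. *)
Definition gauge := forall A, A \in words vals 24 ->
  \sum_(xm <- starts) xm.2 * extension_count vals T A xm.1 =
  \sum_(x <- vals) extension_count vals T A x.

Definition valuation (S W : tree) (A : seq letter) : option N :=
  if [&& size A == 24, all (mem vals) A & slice_ok T A]
  then Some (extensions vals X starts S W A) else None.

Lemma count_solution5_sweep (fuel : nat) (r : N) : uniq vals -> Any \notin vals ->
    classes_ok vals rule T -> boxes_ok vals T X ->
    all (mem vals) [seq xm.1 | xm <- starts] -> gauge ->
    all (all (move_ok vals rule)) gs ->
    sweep (orbit (map (map (cut 24)) gs)) (valuation (slices vals T) (sides vals T))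
          fuel (slices vals T) 0 = Some r ->
  count (solution rule cubes5) (words vals 80) = r.
Proof.
move=> uv pv okT okX oks okg okm swr; rewrite (count_solution5 okT) -[LHS]add0n.
apply: sweepE swr => A s; rewrite /valuation; case: ifP => // /and3P[/eqP sA vA okA] [<-].
have WA : A \in words vals 24 by rewrite mem_words sA vA.
split; last by move=> w; apply: orbitP okm WA w.
rewrite (restcountE okT) // okA -okg //; symmetry; apply: extensionsE => //.
  by move: okA; rewrite /slice_ok /= => /andP[].
by move: okA; rewrite /slice_ok /= => /and3P[].
Qed.

Lemma count_solution4 : classes_ok vals rule T ->
  count (solution rule slice_cells) (words vals 24) = weight (slices vals T).
Proof.
move=> okT; rewrite -sum_count weightE eval_slices.
apply: eq_sum_words => A sA vA; rewrite (solution_obeys okT (_ : cells_ok 24 _)) //.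
Qed.

End Count.

(** * Encoding the unknowns *)

Fixpoint bitseqs (n : nat) : seq bitseq :=
  if n is n.+1 then [seq b :: s | b <- [:: false; true], s <- bitseqs n] else [:: [::]].

Lemma mem_bitseqs n s : (s \in bitseqs n) = (size s == n).
Proof.
elim: n s => [|n IHn] [|b s] //; first by apply/allpairsP => -[[c t] []].
rewrite [RHS]eqSS -IHn; apply/allpairsP/idP => [[[c t] [_ ? [_ ->]]]|] //.
by exists (b, s); split=> //; case: b.
Qed.

(** The set {i, j}, and below the set {i} + L, as characteristic vectors. *)
Definition pair_mask (n i j : nat) : bitseq := [seq (x == i) || (x == j) | x <- iota 0 n].

Definition add_mask (n i : nat) (L : bitseq) : bitseq :=
  [seq (x == i) || nth false L x | x <- iota 0 n].

(** The numbers of the six squares of a 3-face in the list V of all squares, given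
    by the characteristic vectors of ij and K. *)
Definition quad_cell (n : nat) (V : seq (bitseq * bitseq)) (i j k : nat) (L : bitseq) :
    seq nat :=
  let cell i j K := index (pair_mask n i j, K) V in
  [:: cell j k L; cell j k (add_mask n i L); cell i k L; cell i k (add_mask n j L);
      cell i j L; cell i j (add_mask n k L)].

Definition mask_admissible (i j k : nat) (L : bitseq) : bool :=
  uniq [:: i; j; k] && [&& ~~ nth false L i, ~~ nth false L j & ~~ nth false L k].

Definition quad_cells (n : nat) (V : seq (bitseq * bitseq)) : seq (seq nat) :=
  flatten [seq flatten [seq flatten [seq
    [seq quad_cell n V i j k L | L <- bitseqs n & mask_admissible i j k L]
    | k <- iota 0 n] | j <- iota 0 n] | i <- iota 0 n].

Lemma all_flatten (A : Type) (p : pred A) ss : all p (flatten ss) = all (all p) ss.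
Proof. by elim: ss => //= s ss IH; rewrite all_cat IH. Qed.

(** The admissible i, j, k, L run through all 3-faces in all six orders. *)
Definition quads_ok n V cubes : bool :=
  all (mem (flatten (map (@turns nat) cubes))) (quad_cells n V) &&
  all (mem (quad_cells n V)) (flatten (map (@turns nat) cubes)).

Lemma all_solution n V cubes rule w : quads_ok n V cubes ->
  all (fun idx => rule (entries w idx)) (quad_cells n V) = solution rule cubes w.
Proof.
case/andP=> /allP sub1 /allP sub2.
transitivity (all (fun idx => rule (entries w idx)) (flatten (map (@turns nat) cubes))).
  by apply: eq_all_r => idx; apply/idP/idP => [/sub1|/sub2].
rewrite all_flatten all_map; apply: eq_all => idx /=.
by rewrite /cube /entries map_turns all_map.
Qed.

Definition valid_code (c : bitseq * bitseq) : bool :=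
  (count id c.1 == 2) && all (fun b => b.2 ==> ~~ b.1) (zip c.1 c.2).

Definition codes_ok (n : nat) (V : seq (bitseq * bitseq)) : bool :=
  [&& uniq V, all (fun c => (size c.1 == n) && (size c.2 == n)) V
    & all (fun m1 => all (fun m2 => ((m1, m2) \in V) == valid_code (m1, m2))
        (bitseqs n)) (bitseqs n)].

Section Code.

Variable n : nat.

Definition mask (S : {set 'I_n}) : bitseq := [seq i \in S | i <- enum 'I_n].

Definition unmask (m : bitseq) : {set 'I_n} := [set i : 'I_n | nth false m i].

Definition code (x : aindex n) : bitseq * bitseq := (mask x.1, mask x.2).

Definition decode (c : bitseq * bitseq) : aindex n := (unmask c.1, unmask c.2).

Lemma size_mask S : size (mask S) = n.
Proof. by rewrite size_map size_enum_ord. Qed.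

Lemma nth_mask S (i : 'I_n) : nth false (mask S) i = (i \in S).
Proof. by rewrite (nth_map i) ?size_enum_ord // nth_ord_enum. Qed.

Lemma maskK : cancel mask unmask.
Proof. by move=> S; apply/setP => i; rewrite inE nth_mask. Qed.

Lemma unmaskK m : size m = n -> mask (unmask m) = m.
Proof.
move=> sm; apply: (@eq_from_nth _ false); rewrite size_mask // => i lt_i.
by rewrite (nth_mask _ (Ordinal lt_i)) inE.
Qed.

Lemma codeK : cancel code decode.
Proof. by case=> S K; rewrite /decode /= !maskK. Qed.

Lemma map_iota_ord (T : Type) (f : nat -> T) :
  [seq f x | x <- iota 0 n] = [seq f (val i) | i <- enum 'I_n].
Proof. by rewrite -val_enum_ord -map_comp. Qed.

Lemma mask2 (i j : 'I_n) : mask [set i; j] = pair_mask n i j.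
Proof. by rewrite /pair_mask map_iota_ord; apply: eq_map => x; rewrite !inE. Qed.

Lemma maskU1 (i : 'I_n) L : mask (i |: L) = add_mask n i (mask L).
Proof.
by rewrite /add_mask map_iota_ord; apply: eq_map => x; rewrite !inE nth_mask.
Qed.

Lemma valid_codeE x : valid_code (code x) = (x \in Avars n).
Proof.
rewrite inE /valid_code /=; congr ((_ == _) && _).
  by rewrite count_map cardE -size_filter enumT.
rewrite zip_map all_map; apply/allP/subsetP => sub i.
  by move=> Ki; have := sub i (mem_enum _ i); rewrite /= Ki inE.
by move=> _ /=; apply/implyP => /sub; rewrite inE.
Qed.

Lemma forall_iota (P : pred 'I_n) (Q : pred nat) : (forall i, P i = Q i) ->
  [forall i, P i] = all Q (iota 0 n).
Proof.
move=> PQ; rewrite -val_enum_ord all_map; apply/forallP/allP => [allP i _|allQ i].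
  by rewrite /= -PQ.
by rewrite PQ; apply: allQ; rewrite mem_enum.
Qed.

Lemma forall_mask (P : pred {set 'I_n}) (Q : pred bitseq) :
    (forall L, P L = Q (mask L)) ->
  [forall L, P L] = all Q (bitseqs n).
Proof.
move=> PQ; apply/forallP/allP => [allP m|allQ L].
  by rewrite mem_bitseqs => /eqP sm; rewrite -(unmaskK sm) -PQ.
by rewrite PQ; apply: allQ; rewrite mem_bitseqs size_mask.
Qed.

Lemma mask_admissibleE (i j k : 'I_n) L :
  admissible i j k L = mask_admissible i j k (mask L).
Proof.
rewrite /admissible /mask_admissible !nth_mask.
rewrite -[uniq [:: nat_of_ord i; _; _]]/(uniq (map val [:: i; j; k])) (map_inj_uniq val_inj).
by rewrite subsetC !subUset !sub1set !inE -andbA.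
Qed.

Variable V : seq (bitseq * bitseq).
Hypothesis okV : codes_ok n V.

Lemma mem_codes x : (code x \in V) = (x \in Avars n).
Proof.
rewrite -valid_codeE; case/and3P: okV => _ _ /allP/(_ (mask x.1)).
rewrite mem_bitseqs size_mask eqxx => /(_ isT)/allP/(_ (mask x.2)).
by rewrite mem_bitseqs size_mask eqxx => /(_ isT)/eqP.
Qed.

Lemma decodeK : {in V, cancel decode code}.
Proof.
case/and3P: okV => _ /allP szV _ [m1 m2] /szV /= /andP[/eqP s1 /eqP s2].
by rewrite /code /= !unmaskK.
Qed.

Definition word (g : aindex n -> letter) : seq letter := [seq g (decode c) | c <- V].

Lemma nth_word g x : x \in Avars n -> nth Ze (word g) (index (code x) V) = g x.
Proof.
move=> Ax; have Vx : code x \in V by rewrite mem_codes.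
by rewrite (nth_map (code x)) ?index_mem // nth_index // codeK.
Qed.

Lemma entries_word g (i j k : 'I_n) L : admissible i j k L ->
  entries (word g) (quad_cell n V i j k (mask L)) =
  [:: g (avar j k L); g (avar j k (i |: L)); g (avar i k L); g (avar i k (j |: L));
      g (avar i j L); g (avar i j (k |: L))].
Proof.
case/andP; rewrite /= !inE negb_or andbT => /andP[/andP[nij nik] njk].
rewrite subsetC !subUset !sub1set !inE -andbA => /and3P[iL jL kL].
rewrite /entries /quad_cell /= -!maskU1 -!mask2.
have cE a b K : (mask [set a; b], mask K) = code (avar a b K) by [].
rewrite !cE !nth_word // avar_in_Avars ?inE ?negb_or ?nij ?nik ?njk ?iL ?jL ?kL //.
all: by rewrite ?(eq_sym j i) ?(eq_sym k i) ?(eq_sym k j) ?nij ?nik ?njk.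
Qed.

(** A condition at all admissible i, j, k, L that only depends on the labels of
    the six squares is a condition on the word of all labels. *)
Lemma forall_solution cubes rule g (P : 'I_n -> 'I_n -> 'I_n -> {set 'I_n} -> bool) :
    quads_ok n V cubes ->
    (forall i j k L, P i j k L =
       rule [:: g (avar j k L); g (avar j k (i |: L)); g (avar i k L);
                g (avar i k (j |: L)); g (avar i j L); g (avar i j (k |: L))]) ->
  [forall i : 'I_n, forall j : 'I_n, forall k : 'I_n, forall L : {set 'I_n},
     admissible i j k L ==> P i j k L] = solution rule cubes (word g).
Proof.
move=> okq PE; rewrite -(all_solution _ _ okq) /quad_cells all_flatten all_map.
apply: forall_iota => i; rewrite /= all_flatten all_map.
apply: forall_iota => j; rewrite /= all_flatten all_map.
apply: forall_iota => k; rewrite /= all_map all_filter.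
apply: forall_mask => L; rewrite /= -mask_admissibleE.
by case adm: (admissible i j k L); rewrite //= PE -entries_word.
Qed.

Lemma eq_word g g' : word g = word g' -> {in Avars n, g =1 g'}.
Proof. by move=> e x Ax; rewrite -!nth_word // e. Qed.

Lemma word_nth w : size w = size V -> word (fun x => nth Ze w (index (code x) V)) = w.
Proof.
move=> sw; apply: (@eq_from_nth _ Ze); rewrite size_map // => i lt_i.
rewrite (nth_map (code (set0, set0))) // decodeK ?mem_nth // index_uniq //.
by case/and3P: okV.
Qed.

End Code.

Lemma card_words (T : finType) (P : pred T) (enc : T -> seq letter) W (Q : pred (seq letter)) :
    uniq W -> {in P &, injective enc} ->
    (forall f, P f -> enc f \in W /\ Q (enc f)) ->
    (forall w, w \in W -> Q w -> exists2 f, P f & enc f = w) ->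
  #|P| = count Q W.
Proof.
move=> uW inj into onto; rewrite cardE -(size_map enc) -size_filter.
apply/perm_size/uniq_perm; rewrite ?filter_uniq //.
  by rewrite map_inj_in_uniq ?enum_uniq // => f f'; rewrite !mem_enum; apply: inj.
move=> w; rewrite mem_filter; apply/mapP/andP => [[f + ->]|[Qw /onto[] // f Pf <-]].
  by rewrite mem_enum => /into[].
by exists f; rewrite // mem_enum.
Qed.

Section Signs.

Import GRing.Theory.
Local Open Scope ring_scope.

Definition sgn (l : letter) : int :=
  match l with Mi => -1 | Pl => 1 | Ze | Any => 0 end.

Definition letter_of (z : int) : letter :=
  if z == 0 then Ze else if z == 1 then Pl else Mi.

Lemma sgn_mem l : sgn l \in [:: -1; 0; 1].
Proof. by case: l. Qed.

Lemma letter_ofK z : z \in [:: -1; 0; 1] -> sgn (letter_of z) = z.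
Proof. by rewrite !inE => /or3P[] /eqP->. Qed.

Lemma sgnK l : l != Any -> letter_of (sgn l) = l.
Proof. by case: l. Qed.

Definition times (x y : letter) : letter :=
  match x, y with
  | Pl, Pl | Mi, Mi => Pl
  | Pl, Mi | Mi, Pl => Mi
  | _, _ => Ze
  end.

(** The values of three signs form {0}, {-1, 1} or {-1, 0, 1} when -1 and 1 occur
    together or not at all. *)
Definition balance (s : seq letter) : bool := (Mi \in s) == (Pl \in s).

(** The three edge trinomials with all p_I replaced by 1. *)
Definition edge_rule (s : seq letter) : bool :=
  if s is [:: x; x'; y; y'; z; z'] then
    [&& balance [:: x; flip x'; flip (times z y)],
        balance [:: y; flip y'; flip (times z x')]
      & balance [:: z; flip z'; flip (times y' x')]]
  else false.

Lemma sgn_flip x : sgn (flip x) = - sgn x. Proof. by case: x. Qed.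

Lemma sgn_times x y : sgn (times x y) = sgn x * sgn y.
Proof. by case: x; case: y. Qed.

Lemma balanced_sgn x y z : balanced [:: sgn x; sgn y; sgn z] = balance [:: x; y; z].
Proof. by case: x; case: y; case: z. Qed.

Local Arguments assign : simpl never.

Lemma edge_rule_balanced n (f : sign_map n) g i j k L :
    (forall x, sgn (g x) = assign f (inr x)) ->
  all (fun t => balanced (map (term_value f) t)) (edge_trinomials i j k L) =
  edge_rule [:: g (avar j k L); g (avar j k (i |: L)); g (avar i k L);
                g (avar i k (j |: L)); g (avar i j L); g (avar i j (k |: L))].
Proof.
move=> gE; rewrite /= /term_value /= !big_cons !big_nil /a_ /= -!gE.
by rewrite !mul1r !mulr1 !mulN1r -!sgn_times -!sgn_flip !balanced_sgn andbT.
Qed.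

Lemma assign_mem n (f : sign_map n) v : assign f v \in [:: -1; 0; 1].
Proof. by case: v => // x; rewrite /assign; case: insub => // u; apply: ssvalP. Qed.

Lemma assign_in n (f : sign_map n) x (Ax : x \in Avars n) :
  assign f (inr x) = val (f (exist (fun x => x \in Avars n) x Ax)).
Proof. by rewrite /assign (insubT (fun x => x \in Avars n) Ax). Qed.

Variables (n : nat) (V : seq (bitseq * bitseq)) (cubes : seq (seq nat)).
Hypotheses (okV : codes_ok n V) (okq : quads_ok n V cubes).

Definition sign_word (f : sign_map n) : seq letter :=
  word V (fun x => letter_of (assign f (inr x))).

Lemma oriented_word f : oriented_gaussoid f = solution edge_rule cubes (sign_word f).
Proof.
apply: (forall_solution okV (P := fun i j k L => all _ (edge_trinomials i j k L))) => //.
move=> i j k L; apply: (@edge_rule_balanced _ _ (fun x => letter_of (assign f (inr x)))) => x.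
by rewrite letter_ofK ?assign_mem.
Qed.

(** S is the set of the allowed values: {-1, 0, 1} gives the oriented, {0, 1} the
    positive and {-1, 1} the uniform oriented gaussoids. *)
Lemma card_oriented (vals : seq letter) (S : seq int) :
    uniq vals -> Any \notin vals -> (forall l, l != Any -> (sgn l \in S) = (l \in vals)) ->
  #|[pred f : sign_map n | oriented_gaussoid f & [forall x, val (f x) \in S]]| =
  count (solution edge_rule cubes) (words vals (size V)).
Proof.
move=> uv pv SE; apply: (@card_words _ _ sign_word).
- exact: uniq_words.
- move=> f f' _ _ /(eq_word okV) e; apply/ffunP => u; apply: val_inj.
  have := e _ (valP u); rewrite /= /assign !valK => /(congr1 sgn).
  by rewrite !letter_ofK //; apply: ssvalP.
- move=> f /andP[of_f /forallP Sf]; split; last by rewrite -oriented_word.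
  rewrite mem_words size_map eqxx; apply/allP => _ /mapP[c Vc ->] /=.
  have Ac : decode n c \in Avars n by rewrite -(mem_codes okV) (decodeK okV).
  rewrite assign_in; move: (Sf (exist (fun x => x \in Avars n) _ Ac)).
  set z := val _ => Sz.
  have zs : z \in [:: -1; 0; 1] by apply: ssvalP.
  rewrite -SE ?letter_ofK //; by move: zs; rewrite !inE => /or3P[] /eqP->.
move=> w; rewrite mem_words => /andP[/eqP sw /allP vw] sol_w.
pose l (x : aindex n) := nth Ze w (index (code x) V).
have lv x : x \in Avars n -> l x \in vals.
  by move=> Ax; apply: vw; rewrite mem_nth // sw index_mem (mem_codes okV).
have lp x : x \in Avars n -> l x != Any.
  by move=> Ax; apply: contraNneq pv => <-; apply: lv.
pose f : sign_map n := [ffun u => SeqSub (sgn_mem (l (val u)))].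
have fw : sign_word f = w.
  rewrite -[RHS](word_nth okV sw); apply/eq_in_map => c Vc.
  have Ac : decode n c \in Avars n by rewrite -(mem_codes okV) (decodeK okV).
  by rewrite /= assign_in ffunE /= sgnK // lp.
exists f => //; rewrite /= oriented_word fw sol_w /=; apply/forallP => u.
by rewrite ffunE /= SE ?lv ?lp // (valP u).
Qed.

End Signs.

(** The axioms (G1), ..., (G4). The elements of a gaussoid are labelled by [Ze], as
    they are the unknowns that vanish. *)
Definition gaussoid_rule (s : seq letter) : bool :=
  if [seq x == Ze | x <- s] is [:: x; x'; y; y'; z; z'] then
    [&& z && y' ==> y && z', z' && y' ==> z && y, z && y ==> z' && y'
      & z && z' ==> y || x]
  else false.

Section Gaussoids.

Variables (n : nat) (V : seq (bitseq * bitseq)) (cubes : seq (seq nat)).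
Hypotheses (okV : codes_ok n V) (okq : quads_ok n V cubes).

Definition member_word (G : {set aindex n}) : seq letter :=
  word V (fun x => if x \in G then Ze else Pl).

Lemma gaussoid_word G :
  gaussoid G = (G \subset Avars n) && solution gaussoid_rule cubes (member_word G).
Proof.
congr (_ && _); apply: (forall_solution okV) => // i j k L.
rewrite /gaussoid_axioms /gaussoid_rule /=.
have E (b : bool) : ((if b then Ze else Pl) == Ze) = b by case: b.
by rewrite !E.
Qed.

Lemma card_gaussoids : num_gaussoids n =
  count (solution gaussoid_rule cubes) (words [:: Ze; Pl] (size V)).
Proof.
apply: (@card_words _ _ member_word).
- exact: uniq_words.
- move=> G G' /andP[/subsetP GA _] /andP[/subsetP GA' _] /(eq_word okV) e.
  apply/setP => x; case Ax: (x \in Avars n).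
    by have := e x Ax; case: (x \in G); case: (x \in G').
  by rewrite (contraFF (GA x) Ax) (contraFF (GA' x) Ax).
- move=> G; rewrite gaussoid_word => /andP[_ ->]; split=> //.
  rewrite mem_words size_map eqxx; apply/allP => _ /mapP[c _ ->].
  by case: ifP.
move=> w; rewrite mem_words => /andP[/eqP sw /allP vw] sol_w.
pose G := [set x in Avars n | nth Ze w (index (code x) V) == Ze].
have Gw : member_word G = w.
  rewrite -[RHS](word_nth okV sw); apply/eq_in_map => c Vc.
  have Ac : decode n c \in Avars n by rewrite -(mem_codes okV) (decodeK okV).
  rewrite inE Ac /=; have : nth Ze w (index (code (decode n c)) V) \in [:: Ze; Pl].
    by apply: vw; rewrite mem_nth // sw index_mem (mem_codes okV).
  by rewrite !inE => /orP[] /eqP->.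
exists G => //; rewrite gaussoid_word Gw sol_w andbT.
by apply/subsetP => x; rewrite inE => /andP[].
Qed.

End Gaussoids.

(** * The first letter of a link *)

Section Gauge.

Variables (vals : seq letter) (rule : seq letter -> bool) (T : class_table).

Lemma obeys_flip a d b1 b2 b3 b4 : classes_ok vals rule T -> flips_ok vals rule ->
    all (mem vals) [:: a; d; b1; b2; b3; b4] ->
  obeys T [:: a; d; flip b1; flip b2; flip b3; flip b4] =
  obeys T [:: a; d; b1; b2; b3; b4].
Proof.
move=> okT /andP[fv okf] vs; pose bs := [:: false; false; true; true; true; true].
have bs_even : bs \in even_patterns by [].
have imp s : s \in words vals 6 -> cube rule s -> cube rule (reflect_word bs s).
  by move=> Ws; apply: (implyP (allP (allP okf _ bs_even) _ Ws)).
pose s := [:: a; d; b1; b2; b3; b4].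
have Ws : s \in words vals 6 by rewrite mem_words vs.
have Wr : reflect_word bs s \in words vals 6 by apply: reflect_words.
rewrite -[[:: a; d; flip _; _; _; _]]/(reflect_word bs s) -/s.
move: (Wr); rewrite mem_words => /andP[/eqP sr vr].
rewrite !(classes_okP okT) //; apply/idP/idP => [/(imp _ Wr)|]; last exact: imp.
by rewrite reflectK.
Qed.

(** Negating the signs of the whole link preserves solutions and leaves A and D
    alone, so opposite letters of one link square have equally many
    extensions. *)
Lemma gauge_flips starts : classes_ok vals rule T -> flips_ok vals rule ->
    (forall F : letter -> nat, (forall x, x \in vals -> F (flip x) = F x) ->
       \sum_(xm <- starts) nat_of_bin xm.2 * F xm.1 = \sum_(x <- vals) F x) ->
  gauge vals T starts.
Proof.
move=> okT okf starts_sum A; rewrite mem_words => /andP[/eqP sA vA].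
apply: starts_sum => x vx; apply: extension_count_flip => //.
  by case/andP: okf.
by move=> a d b1 b2 b3 b4 vs; apply: obeys_flip.
Qed.

Lemma gauge_trivial : gauge vals T [seq (x, 1%num) | x <- vals].
Proof. by move=> A _; rewrite big_map; apply: eq_bigr => x _; rewrite mul1n. Qed.

End Gauge.

(** * Numbering the squares of the cubes of dimension 3, 4 and 5 *)

(** Squares as pairs of lists ij and K, in the order of the numbering above. *)
Definition square_vars : seq (seq nat * seq nat) :=
  [:: ([:: 0; 1], [::]); ([:: 0; 1], [:: 2]); ([:: 0; 2], [::]);
      ([:: 0; 2], [:: 1]); ([:: 1; 2], [::]); ([:: 1; 2], [:: 0])].

Definition edge_vars (m : nat) : seq (seq nat * seq nat) :=
  [:: ([:: 0; m], [::]); ([:: 1; m], [::]); ([:: 0; m], [:: 1]);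
      ([:: 1; m], [:: 0]); ([:: 2; m], [::]); ([:: 0; m], [:: 2]);
      ([:: 2; m], [:: 0]); ([:: 1; m], [:: 2]); ([:: 2; m], [:: 1]);
      ([:: 0; m], [:: 1; 2]); ([:: 1; m], [:: 0; 2]); ([:: 2; m], [:: 0; 1])].

Definition raise (m : nat) (vs : seq (seq nat * seq nat)) : seq (seq nat * seq nat) :=
  [seq (v.1, m :: v.2) | v <- vs].

Definition slice_vars : seq (seq nat * seq nat) :=
  edge_vars 3 ++ square_vars ++ raise 3 square_vars.

Definition vars5 : seq (seq nat * seq nat) :=
  slice_vars ++ raise 4 slice_vars ++
  [seq ([:: 3; 4], K) | K <- [:: [::]; [:: 0]; [:: 1]; [:: 0; 1]; [:: 2]; [:: 0; 2];
                                 [:: 1; 2]; [:: 0; 1; 2]]] ++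
  edge_vars 4 ++ raise 3 (edge_vars 4).

Definition encode (n : nat) (vs : seq (seq nat * seq nat)) : seq (bitseq * bitseq) :=
  [seq ([seq x \in v.1 | x <- iota 0 n], [seq x \in v.2 | x <- iota 0 n]) | v <- vs].

Definition codes3 := encode 3 square_vars.
Definition codes4 := encode 4 slice_vars.
Definition codes5 := encode 5 vars5.

Lemma codes_ok3 : codes_ok 3 codes3. Proof. by vm_compute. Qed.
Lemma codes_ok4 : codes_ok 4 codes4. Proof. by vm_compute. Qed.
Lemma codes_ok5 : codes_ok 5 codes5. Proof. by vm_compute. Qed.

Lemma quads_ok3 : quads_ok 3 codes3 [:: cube_squares]. Proof. by vm_compute. Qed.
Lemma quads_ok4 : quads_ok 4 codes4 slice_cells. Proof. by vm_compute. Qed.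
Lemma quads_ok5 : quads_ok 5 codes5 cubes5. Proof. by vm_compute. Qed.

Definition swap (a b : nat) (m : bitseq) : bitseq :=
  [seq nth false m (if x == a then b else if x == b then a else x) | x <- iota 0 5].

Definition transposition (a b : nat) : move :=
  Relabel [seq index (swap a b c.1, swap a b c.2) codes5 | c <- codes5].

Definition reflection (i : nat) : move := Reflect [seq nth false c.1 i | c <- codes5].

(** Every permutation of 0, 1, 2, 3 is a product of transpositions, one from each
    level or none. *)
Definition relabelings : seq (seq move) :=
  [:: [:: transposition 0 1]; [:: transposition 0 2; transposition 1 2];
      [:: transposition 0 3; transposition 1 3; transposition 2 3]].

(** The sign changes for 3 and 4 add nothing: those for 0, 1, 2 and 3 together
    fix all squares of A, and so does the one for 4. *)
Definition reflections : seq (seq move) :=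
  [:: [:: reflection 0]; [:: reflection 1]; [:: reflection 2]].

Definition is_relabel (g : move) : bool :=
  if g is Relabel m then relabel_ok m else false.
Definition is_reflect (g : move) : bool :=
  if g is Reflect bs then reflect_ok bs else false.

Lemma relabelings_ok : all (all is_relabel) relabelings. Proof. by vm_compute. Qed.
Lemma reflections_ok : all (all is_reflect) reflections. Proof. by vm_compute. Qed.

Lemma relabelings_move_ok vals rule : all (all (move_ok vals rule)) relabelings.
Proof.
by apply: sub_all relabelings_ok => hs; apply: sub_all => -[m|bs].
Qed.

Lemma reflections_move_ok vals rule : flips_ok vals rule ->
  all (all (move_ok vals rule)) reflections.
Proof.
move=> okf; apply: sub_all reflections_ok => hs; apply: sub_all => -[m|bs] //= ->.
by rewrite okf.
Qed.

(** * Evaluation *)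

Definition all_letters := [:: Mi; Ze; Pl].
Definition nonzero_letters := [:: Mi; Pl].
Definition nonneg_letters := [:: Ze; Pl].

Section Counts.

Variables (vals : seq letter) (rule : seq letter -> bool).

Definition rule_classes := make_classes vals rule.
Definition rule_boxes := make_boxes vals rule_classes.

Definition tables_ok : bool :=
  [&& uniq vals, Any \notin vals, classes_ok vals rule rule_classes
    & boxes_ok vals rule_classes rule_boxes].

Definition count3 : N := weight (three_cubes vals rule_classes).
Definition count4 : N := weight (slices vals rule_classes).
Definition count5 (starts : seq (letter * N)) (gs : seq (seq move)) : option N :=
  let S := slices vals rule_classes in
  (* 300 exceeds the number of orbits. *)
  sweep (orbit (map (map (cut 24)) gs))
    (valuation vals rule_classes rule_boxes starts S (sides vals rule_classes)) 300 S 0.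

Hypothesis ok : tables_ok.

Lemma count3E : count (solution rule [:: cube_squares]) (words vals (size codes3)) = count3.
Proof.
have /and4P[_ _ okT _] := ok.
rewrite -sum_count weightE eval_three_cubes; apply: eq_sum_words => w sw vw.
rewrite (solution_obeys okT (_ : cells_ok 6 _)) //= andbT.
by case: (obeys _ _).
Qed.

Lemma count4E : count (solution rule slice_cells) (words vals (size codes4)) = count4.
Proof. by have /and4P[_ _ okT _] := ok; apply: count_solution4. Qed.

Lemma count5E starts gs r : all (mem vals) [seq xm.1 | xm <- starts] ->
    gauge vals rule_classes starts -> all (all (move_ok vals rule)) gs ->
    count5 starts gs = Some r ->
  count (solution rule cubes5) (words vals (size codes5)) = r.
Proof.
by have /and4P[uv pv okT okX] := ok => ? ? ?; apply: count_solution5_sweep.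
Qed.

End Counts.

Lemma oriented_tables_ok : tables_ok all_letters edge_rule.
Proof. by vm_compute. Qed.
Lemma positive_tables_ok : tables_ok nonneg_letters edge_rule.
Proof. by vm_compute. Qed.
Lemma uniform_tables_ok : tables_ok nonzero_letters edge_rule.
Proof. by vm_compute. Qed.
Lemma gaussoid_tables_ok : tables_ok nonneg_letters gaussoid_rule.
Proof. by vm_compute. Qed.

Lemma oriented_flips_ok : flips_ok all_letters edge_rule.
Proof. by vm_compute. Qed.
Lemma uniform_flips_ok : flips_ok nonzero_letters edge_rule.
Proof. by vm_compute. Qed.

(** One letter of each pair of opposite letters, with multiplicity the size of the
    pair. *)
Definition oriented_starts := [:: (Ze, 1%num); (Pl, 2%num)].
Definition uniform_starts := [:: (Pl, 2%num)].
Definition unit_starts (vals : seq letter) := [seq (x, 1%num) | x <- vals].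

Lemma oriented_gauge :
  gauge all_letters (rule_classes all_letters edge_rule) oriented_starts.
Proof.
have /and4P[_ _ okT _] := oriented_tables_ok.
apply: gauge_flips okT oriented_flips_ok _ => F flipF.
have FPl : F Pl = F Mi by apply: (flipF Mi).
by rewrite !big_cons !big_nil !addn0 /= FPl mul1n mul2n -addnn addnCA.
Qed.

Lemma uniform_gauge :
  gauge nonzero_letters (rule_classes nonzero_letters edge_rule) uniform_starts.
Proof.
have /and4P[_ _ okT _] := uniform_tables_ok.
apply: gauge_flips okT uniform_flips_ok _ => F flipF.
have FPl : F Pl = F Mi by apply: (flipF Mi).
by rewrite !big_cons !big_nil !addn0 /= FPl mul2n -addnn.
Qed.

Definition flag_moves := relabelings ++ reflections.

Lemma flag_moves_ok vals rule : flips_ok vals rule ->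
  all (all (move_ok vals rule)) flag_moves.
Proof. by move=> okf; rewrite all_cat relabelings_move_ok reflections_move_ok. Qed.

Lemma oriented_count5 : count5 all_letters edge_rule oriented_starts flag_moves
  = Some 54936241913%num.
Proof. vm_cast_no_check (erefl (Some 54936241913%num)). Qed.

Lemma uniform_count5 : count5 nonzero_letters edge_rule uniform_starts flag_moves
  = Some 878349984%num.
Proof. vm_cast_no_check (erefl (Some 878349984%num)). Qed.

Lemma positive_count5 : count5 nonneg_letters edge_rule (unit_starts nonneg_letters) relabelings
  = Some 1024%num.
Proof. vm_cast_no_check (erefl (Some 1024%num)). Qed.

Lemma gaussoid_count5 : count5 nonneg_letters gaussoid_rule (unit_starts nonneg_letters) relabelings
  = Some 60212776%num.
Proof. vm_cast_no_check (erefl (Some 60212776%num)). Qed.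

Section Totals.

Variables (n : nat) (V : seq (bitseq * bitseq)) (cubes : seq (seq nat)).
Hypotheses (okV : codes_ok n V) (okq : quads_ok n V cubes).

Lemma num_orientedE : num_oriented n =
  count (solution edge_rule cubes) (words all_letters (size V)).
Proof.
rewrite -(card_oriented okV okq (S := [:: -1; 0; 1]%R)) //; last by case.
apply: eq_card => f; rewrite !inE /=; symmetry.
by rewrite andb_idr // => _; apply/forallP => u; apply: ssvalP.
Qed.

Lemma num_positiveE : num_positive n =
  count (solution edge_rule cubes) (words nonneg_letters (size V)).
Proof. by rewrite -(card_oriented okV okq (S := [:: 0; 1]%R)) //; case. Qed.

Lemma num_uniformE : num_uniform n =
  count (solution edge_rule cubes) (words nonzero_letters (size V)).
Proof. by rewrite -(card_oriented okV okq (S := [:: -1; 1]%R)) //; case. Qed.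

Lemma num_gaussoidsE : num_gaussoids n =
  count (solution gaussoid_rule cubes) (words nonneg_letters (size V)).
Proof. exact: card_gaussoids. Qed.

End Totals.

Lemma counts3 :
  [/\ num_gaussoids 3 = 11, num_oriented 3 = 51, num_positive 3 = 8 & num_uniform 3 = 20].
Proof.
have [vG vO vP vU] :
    [/\ count3 nonneg_letters gaussoid_rule = 11%num, count3 all_letters edge_rule = 51%num,
        count3 nonneg_letters edge_rule = 8%num & count3 nonzero_letters edge_rule = 20%num].
  by vm_compute.
split.
- by rewrite (num_gaussoidsE codes_ok3 quads_ok3) count3E ?vG //; apply: gaussoid_tables_ok.
- by rewrite (num_orientedE codes_ok3 quads_ok3) count3E ?vO //; apply: oriented_tables_ok.
- by rewrite (num_positiveE codes_ok3 quads_ok3) count3E ?vP //; apply: positive_tables_ok.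
- by rewrite (num_uniformE codes_ok3 quads_ok3) count3E ?vU //; apply: uniform_tables_ok.
Qed.

Lemma counts4 :
  [/\ num_gaussoids 4 = 679, num_oriented 4 = 34873%num,
      num_positive 4 = 64 & num_uniform 4 = 5376%num].
Proof.
have [vG vO vP vU] :
    [/\ count4 nonneg_letters gaussoid_rule = 679%num,
        count4 all_letters edge_rule = 34873%num,
        count4 nonneg_letters edge_rule = 64%num
      & count4 nonzero_letters edge_rule = 5376%num].
  by vm_compute.
split.
- by rewrite (num_gaussoidsE codes_ok4 quads_ok4) count4E ?vG //; apply: gaussoid_tables_ok.
- by rewrite (num_orientedE codes_ok4 quads_ok4) count4E ?vO //; apply: oriented_tables_ok.
- by rewrite (num_positiveE codes_ok4 quads_ok4) count4E ?vP //; apply: positive_tables_ok.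
- by rewrite (num_uniformE codes_ok4 quads_ok4) count4E ?vU //; apply: uniform_tables_ok.
Qed.

Lemma counts5 :
  [/\ num_gaussoids 5 = 60212776%num, num_oriented 5 = 54936241913%num,
      num_positive 5 = 1024 & num_uniform 5 = 878349984%num].
Proof.
split.
- rewrite (num_gaussoidsE codes_ok5 quads_ok5).
  refine (count5E gaussoid_tables_ok _ _ _ gaussoid_count5).
  + by [].
  + exact: (@gauge_trivial nonneg_letters).
  + exact: relabelings_move_ok.
- rewrite (num_orientedE codes_ok5 quads_ok5).
  refine (count5E oriented_tables_ok _ oriented_gauge _ oriented_count5).
  + by [].
  + exact: flag_moves_ok oriented_flips_ok.
- rewrite (num_positiveE codes_ok5 quads_ok5); transitivity (nat_of_bin 1024%num).
    refine (count5E positive_tables_ok _ _ _ positive_count5).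
    + by [].
    + exact: (@gauge_trivial nonneg_letters).
    + exact: relabelings_move_ok.
  by [].
- rewrite (num_uniformE codes_ok5 quads_ok5).
  refine (count5E uniform_tables_ok _ uniform_gauge _ uniform_count5).
  + by [].
  + exact: flag_moves_ok uniform_flips_ok.
Qed.

Theorem theorem5p3 :
  [/\ [/\ num_gaussoids 3 = 11, num_oriented 3 = 51,
          num_positive 3 = 8 & num_uniform 3 = 20],
      [/\ num_gaussoids 4 = 679, num_oriented 4 = 34873%num,
          num_positive 4 = 64 & num_uniform 4 = 5376%num]
    & [/\ num_gaussoids 5 = 60212776%num, num_oriented 5 = 54936241913%num,
          num_positive 5 = 1024 & num_uniform 5 = 878349984%num]].
Proof. exact: And3 counts3 counts4 counts5. Qed.
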